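(* Let $\chi_N^2=\lambda_n^{-1}\sum_{m=1}^N(\eta_m-\lambda_n)^2$ be the chi-square statistic, and consider a sequence of alternatives in the intermediate family $\mathfrak{I}_{alt}$. If either (i) $n\lambda_n^3\to\infty$ and $\varepsilon(N)\ll\left(n\max(1,\lambda_n^2)\right)^{-1/3}$; or (ii) for some $\gamma\in(1/4,1/3]$ one has $n^{(1-3\gamma)/(1-2\gamma)}\ll N\ll n^{3(1-2\gamma)/(4(1-\gamma))}$ and $\varepsilon(N)=(n\lambda_n^2)^{-\gamma}$, then, as $n\to\infty$, $$\frac{e_N^{\alpha}(\chi_N^2)}{n\lambda_n\,\varepsilon^2(N)}=\frac14(1+o(1)).$$ (iii) If $\varepsilon(N)=(n\lambda_n)^{-1/3}\omega_n^{2/3}$, where $\max\left(1,\log(N^2/n)\right)\ll\omega_n\ll\sqrt{n\lambda_n}$, then, as $n\to\infty$, $$\frac{e_N^{\alpha}(\chi_N^2)}{n\lambda_n\,\varepsilon^2(N)}=o(1).$$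
   Context: All asymptotics are as $n\to\infty$; $a_n\ll b_n$ means $a_n=o(b_n)$. $N=N(n)\to\infty$, $\lambda_n=n/N$ converges to a limit in $[0,\infty]$, and $n^2/N=n\lambda_n\to\infty$. The random vector $(\eta_1,\dots,\eta_N)$ has the multinomial distribution with $n$ trials and cell probabilities $(p_1,\dots,p_N)$, $p_m>0$, $\sum_m p_m=1$. The hypothesis is $H_0: p_m=1/N$ for all $m$; $P_0$ denotes probability under $H_0$. Alternatives $H_{1n}$ are sequences $p_m=N^{-1}(1+\varepsilon_{m,n})\ (m=1,\dots,N)$, not identically uniform, with $\sum_m\varepsilon_{m,n}=0$, $\max_{m}|\varepsilon_{m,n}|\to0$; put $\varepsilon(N)=\frac1N\sum_{m=1}^N(Np_m-1)^2$, so $\varepsilon(N)\to0$. The intermediate family $\mathfrak{I}_{alt}$ consists of all such sequences of alternatives with $\sqrt{n\lambda_n}\,\varepsilon(N)\to\infty$ and $\varepsilon(N)=o(\lambda_n^{-1})$. For a function $h$ on $\{0,1,2,\dots\}$ (possibly depending on $\lambda_n$) let $S_N^h=\sum_{m=1}^N h(\eta_m)$ (large values reject $H_0$), let $A_1(h)=N^{-1}\sum_{m=1}^N E\,h(\xi_m)$ where $\xi_m$ is Poisson with parameter $np_m$, the $p_m$ being the cell probabilities under $H_{1n}$, and define $$e_N^{\alpha}(S_N^h)=-\log P_0\{S_N^h>N A_1(h)\}.$$ The statistic $\chi_N^2$ is $S_N^h$ with $h(x)=(x-\lambda_n)^2/\lambda_n$. *)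

(* Defs.v *)
From HB Require Import structures.
From mathcomp Require Import all_boot all_order all_algebra.
From mathcomp Require Import all_classical all_reals all_analysis.

Set Implicit Arguments.
Unset Strict Implicit.
Unset Printing Implicit Defensive.

Import Order.TTheory GRing.Theory Num.Theory.
Import numFieldNormedType.Exports.

Local Open Scope classical_set_scope.
Local Open Scope ring_scope.

Section multinomial.
Context {R : realType}.

Definition multinomial_pmf (N n : nat) (p : 'I_N -> R)
    (eta : {ffun 'I_N -> 'I_n.+1}) : R :=
  if (\sum_(m < N) eta m)%N == n then
    n`!%:R / (\prod_(m < N) (eta m)`!%:R) * \prod_(m < N) p m ^+ eta m
  else 0.

Definition multinomial_prob (N n : nat) (p : 'I_N -> R)
    (A : pred {ffun 'I_N -> 'I_n.+1}) : R :=
  \sum_(eta | A eta) multinomial_pmf p eta.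

Definition uniform_cells (N : nat) : 'I_N -> R := fun=> N%:R^-1.

Definition S_stat (N n : nat) (h : nat -> R)
    (eta : {ffun 'I_N -> 'I_n.+1}) : R :=
  \sum_(m < N) h (eta m).

(* The last argument of poisson_prob is a dummy in the library. *)
Definition A1 (N n : nat) (p : 'I_N -> R) (h : nat -> R) : \bar R :=
  ((N%:R^-1)%:E * \sum_(m < N) 'E_(poisson_prob (n%:R * p m) 0%N)[h])%E.

(* e_N^alpha of S_N^h. Extended-real valued: it is +oo when the event has probability 0, whereas
   the real-valued ln would give - ln 0 = 0. *)
Definition alpha_slope (N n : nat) (p : 'I_N -> R) (h : nat -> R) : \bar R :=
  (- lne (multinomial_prob (@uniform_cells N)
      [pred eta : {ffun 'I_N -> 'I_n.+1} |
        (N%:R%:E * A1 n p h < (S_stat h eta)%:E)%E])%:E)%E.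

Definition lambda (N : nat -> nat) (n : nat) : R := n%:R / (N n)%:R.

Definition chi2_score (lam : R) (x : nat) : R := (x%:R - lam) ^+ 2 / lam.

Definition is_alternative (N : nat) (p : 'I_N -> R) : Prop :=
  [/\ forall m, 0 < p m, \sum_(m < N) p m = 1 & exists m, p m != N%:R^-1].

Definition max_dev (N : nat) (p : 'I_N -> R) : R :=
  \big[Num.max/0]_(m < N) `|N%:R * p m - 1|.

(* epsilon(N) *)
Definition mean_sq_dev (N : nat) (p : 'I_N -> R) : R :=
  N%:R^-1 * \sum_(m < N) (N%:R * p m - 1) ^+ 2.

Definition much_less (a b : nat -> R) : Prop :=
  (a : nat -> R^o) =o_\oo (b : nat -> R^o).

Definition standing_assumptions (N : nat -> nat) : Prop :=
  [/\ N n @[n --> \oo] --> \oo,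
      exists l : \bar R, (lambda N n)%:E @[n --> \oo] --> l &
      n%:R * lambda N n @[n --> \oo] --> +oo].

(* The conditions bear on large n only; sum_m eps_{m,n} = 0 follows from
   sum_m p_m = 1, with eps_{m,n} = N p_m - 1. *)
Definition alternatives (N : nat -> nat) (p : forall n, 'I_(N n) -> R) : Prop :=
  (\forall n \near \oo, is_alternative (p n)) /\
  max_dev (p n) @[n --> \oo] --> 0.

Definition intermediate (N : nat -> nat) (p : forall n, 'I_(N n) -> R) : Prop :=
  [/\ alternatives p,
      Num.sqrt (n%:R * lambda N n) * mean_sq_dev (p n) @[n --> \oo] --> +oo &
      much_less (fun n => mean_sq_dev (p n)) (fun n => (lambda N n)^-1)].

End multinomial.

Notation "a '<<_oo' b" := (much_less a b) (at level 70, no associativity).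

(* Main.v *)
Require Import Defs.
From HB Require Import structures.
From mathcomp Require Import all_boot all_order all_algebra.
From mathcomp Require Import all_classical all_reals all_analysis.
From mathcomp Require Import ring lra.

Set Implicit Arguments.
Unset Strict Implicit.
Unset Printing Implicit Defensive.

Import Order.TTheory GRing.Theory Num.Theory.
Import numFieldNormedType.Exports.

Local Open Scope classical_set_scope.
Local Open Scope ring_scope.

(** Write lam = n/N, v = n lam = n^2/N, eps for the mean square deviation of
the alternative, and y = v eps^2. Poisson moments give N A1 = N + n eps, so the
slope is minus the logarithm of the probability, under uniform cells, that
W_n > v eps + lam, where W_j = sum_i x_i (x_i - 1) - j (j - 1) / N is the centred
pair count after j balls (lemma [alpha_slope_chi2]).

Throw the balls one at a time. Then W is a martingale: a ball falling in cell m
adds 2 (x_m - j/N). The conditional second moment of this increment is affine in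
W itself, hence the moment generating function of W satisfies a closed recursion
in which the tilt is only slightly displaced by each throw. Summing the recursion
gives E exp(th W_n) = exp(th^2 v (1 + o(1))) for th of order eps, with no loss of
any factor polynomial in n; such a loss would matter, since y may tend to
infinity arbitrarily slowly. The recursion needs bounded increments, so paths are
dropped as soon as one cell exceeds its mean by L, where L is a small multiple of
1/eps. The dropped paths have probability at most exp(-L/2) up to polynomial
factors, and this is negligible against exp(-y) as soon as n lam^3 >= 1 and
n lam eps^3 -> 0, because then 1/eps dominates both log n and y. See
[killed_mgf_le], [killed_mgf_ge] and [throw_exp_untame].

Chernoff's inequality at the tilt eps/2 bounds the tail by exp(-y/4 (1 + o(1)))
([excess_tail_le]); an exponential change of measure, with the same generating
function bounds used at neighbouring tilts to show concentration under the tilted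
measure, gives the matching lower bound ([excess_tail_ge]). Either hypothesis of
the first part implies n lam^3 >= 1 eventually and n lam eps^3 -> 0, which is the
Gaussian regime.

In the second part, n lam eps^3 = omega^2 tends to infinity instead, and one crowded
cell is cheaper than a collective deviation. Putting k, about 2 sqrt(v eps), balls
into one cell costs about k log(k/lam), while the remaining balls, by Chebyshev's
inequality, keep their pair count near its mean with probability at least 1/2
([crowded_cell_prob]). As k / y = 2 / omega and log(k/lam) is at most a constant times
max(1, log(N^2/n)), this cost is o(y), so the ratio tends to 0. *)

(** * Quadratic bounds for the exponential *)

Section exponential_bounds.
Context {R : realType}.
Implicit Types (u d c : R).

(** The function [(1 + x + c x^2/2) exp(-x)] is 1 at 0 and has derivative
[x (c - 1 - c x / 2) exp(-x)]. Near 0 the middle factor has the sign of [c - 1],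
so that [c = 1 + d] and [c = 1 - d] give bounds on [expR] on both sides of 0 with
the quadratic coefficient as close to 1/2 as desired. *)
Lemma expR_quadratic_mvt c u : exists2 xi : R, 0 <= xi * u /\ `|xi| <= `|u| &
  (1 + u + c * u ^+ 2 / 2) * expR (- u) - 1
    = xi * u * ((c - 1) - c * xi / 2) * expR (- xi).
Proof.
pose f (x : R) := (1 + x + c * x ^+ 2 / 2) * expR (- x).
pose df (x : R) := x * ((c - 1) - c * x / 2) * expR (- x).
have fdf (x : R) : is_derive x (1 : R) f (df x).
  rewrite /f; apply: is_derive_eq.
  have E (e : R) : (1 + x + c * x ^+ 2 / 2) * (e * -1) +
      e * (0 + 1 + (0 + 2^-1 * (c * (x * 1 + x * 1)))) =
      x * (c - 1 - c * x / 2) * e by field.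
  by rewrite /df /GRing.scale /= -E !mulr0.
have cf a b : {within `[a, b], continuous f}.
  apply: derivable_within_continuous => x _; exact: ex_derive.
have f0 : f 0 = 1 by rewrite /f oppr0 expR0; ring.
case: (leP 0 u) => u0.
- have [xi] := MVT_segment u0 (fun x _ => fdf x) (cf _ _).
  rewrite in_itv /= => /andP[x0 xu] E; exists xi.
    by split; [rewrite mulr_ge0 | rewrite !ger0_norm].
  move: E; rewrite f0 -/(f u) => ->; rewrite /df; ring.
- have [xi] := MVT_segment (ltW u0) (fun x _ => fdf x) (cf _ _).
  rewrite in_itv /= => /andP[xu x0] E; exists xi.
    by split; [rewrite mulr_le0 // ltW | rewrite !ler0_norm ?lerN2 // ltW].
  move: E; rewrite f0 -/(f u) => E.
  have -> : f u - 1 = - (1 - f u) by ring.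
  rewrite E /df; ring.
Qed.

Lemma expR_le_quadratic d u : 0 <= d <= 1 -> u <= d ->
  expR u <= 1 + u + (1 + d) * u ^+ 2 / 2.
Proof.
move=> /andP[d0 d1] ud.
have [xi [xu xle] E] := expR_quadratic_mvt (1 + d) u.
have xid : xi <= d.
  case: (ltP 0 xi) => [x0|x0]; last exact: le_trans x0 d0.
  have u0 : 0 <= u by move: xu; rewrite pmulr_rge0.
  by rewrite (le_trans _ ud)// -(ger0_norm u0) (le_trans (ler_norm _)).
have h : 0 <= (1 + u + (1 + d) * u ^+ 2 / 2) * expR (- u) - 1.
  rewrite E mulr_ge0 ?expR_ge0// mulr_ge0//; nra.
rewrite -[leLHS]mul1r -ler_pdivlMr ?expR_gt0// -expRN; lra.
Qed.

Lemma expR_ge_quadratic d u : 0 <= d <= 1 -> - d <= u ->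
  1 + u + (1 - d) * u ^+ 2 / 2 <= expR u.
Proof.
move=> /andP[d0 d1] ud.
have [xi [xu xle] E] := expR_quadratic_mvt (1 - d) u.
have xid : - d <= xi.
  case: (ltP xi 0) => [x0|x0]; last by rewrite (le_trans _ x0)// oppr_le0.
  have u0 : u <= 0 by move: xu; rewrite nmulr_rge0.
  by move: xle; rewrite !ler0_norm ?(ltW x0)// => ?; lra.
have h : (1 + u + (1 - d) * u ^+ 2 / 2) * expR (- u) - 1 <= 0.
  rewrite E mulr_le0_ge0 ?expR_ge0// mulr_ge0_le0//; nra.
rewrite -[leRHS]mul1r -ler_pdivrMr ?expR_gt0// -expRN; lra.
Qed.

(** [1 + y] is turned back into an exponential, at the price of a factor [1 - d]
in the exponent. *)
Lemma expR_mul1B_le d y : 0 <= y <= d -> expR ((1 - d) * y) <= 1 + y.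
Proof.
move=> /andP[y0 yd].
have h : 1 - (1 - d) * y <= expR (- ((1 - d) * y)).
  by rewrite (le_trans _ (expR_ge1Dx _)).
have e0 := expR_gt0 ((1 - d) * y).
have : (1 + y) * (1 - (1 - d) * y) >= 1 by nra.
move: h; rewrite expRN => h h2.
have y1 : 0 < 1 + y by lra.
have h3 : 1 <= (1 + y) / expR ((1 - d) * y).
  by rewrite (le_trans h2)// ler_pM2l.
by move: h3; rewrite ler_pdivlMr ?mul1r.
Qed.

(** This mean is the factor by which one throw multiplies a moment generating
function. The coefficient of the variance has to be 1/2 up to [1 + d]: the limit
1/4 of the theorem is read off from it. *)
Lemma mean_expR_le N (u : 'I_N -> R) d : (0 < N)%N -> 0 <= d <= 1 ->
  \sum_m u m = 0 -> (forall m, u m <= d) ->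
  \sum_m N%:R^-1 * expR (u m)
    <= expR ((1 + d) / 2 * (N%:R^-1 * \sum_m u m ^+ 2)).
Proof.
move=> N0 d01 su0 ud; apply: le_trans (expR_ge1Dx _).
have N0' : N%:R != 0 :> R by rewrite pnatr_eq0 -lt0n.
have -> : 1 + (1 + d) / 2 * (N%:R^-1 * \sum_m u m ^+ 2) =
    \sum_m N%:R^-1 * (1 + u m + (1 + d) * u m ^+ 2 / 2).
  rewrite -big_distrr /= !big_split /= su0 sumr_const card_ord -mulr_suml.
  by rewrite -mulr_sumr !mulrDr mulVf//; ring.
by apply: ler_sum => m _; rewrite ler_wpM2l ?invr_ge0// expR_le_quadratic.
Qed.

Lemma mean_expR_ge N (u : 'I_N -> R) d : (0 < N)%N -> 0 <= d <= 1 ->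
  \sum_m u m = 0 -> (forall m, `|u m| <= d) ->
  expR ((1 - d) ^+ 2 / 2 * (N%:R^-1 * \sum_m u m ^+ 2))
    <= \sum_m N%:R^-1 * expR (u m).
Proof.
move=> N0 /andP[d0 d1] su0 ud.
have N0' : N%:R != 0 :> R by rewrite pnatr_eq0 -lt0n.
pose q := N%:R^-1 * \sum_m u m ^+ 2.
have q0 : 0 <= q by rewrite mulr_ge0 ?invr_ge0// sumr_ge0// => m _; exact: sqr_ge0.
have qd : q <= d.
  rewrite /q -[leRHS](@mulKf _ N%:R)// ler_wpM2l ?invr_ge0//.
  rewrite -[N in N%:R * _]card_ord mulr_natl -sumr_const ler_sum// => m _.
  by rewrite -real_normK ?num_real// expr2 (le_trans (ler_piMr _ (le_trans (ud m) d1))).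
have -> : (1 - d) ^+ 2 / 2 * q = (1 - d) * ((1 - d) / 2 * q) by ring.
apply: (@le_trans _ _ (1 + (1 - d) / 2 * q)).
  by apply: expR_mul1B_le; apply/andP; split; nra.
have -> : 1 + (1 - d) / 2 * q =
    \sum_m N%:R^-1 * (1 + u m + (1 - d) * u m ^+ 2 / 2).
  rewrite /q -big_distrr /= !big_split /= su0 sumr_const card_ord -mulr_suml.
  by rewrite -mulr_sumr !mulrDr mulVf//; ring.
apply: ler_sum => m _; rewrite ler_wpM2l ?invr_ge0// expR_ge_quadratic ?d0//.
by have := ud m; rewrite ler_norml => /andP[].
Qed.

End exponential_bounds.

(** * Throwing balls one at a time *)

Section sequential_throws.
Context {R : realType} {N : nat}.
Local Notation state := ('I_N -> nat).
Implicit Types (x : state) (w : 'I_N -> R) (alive : nat -> pred state)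
  (f g : state -> R).

Definition throw x (m : 'I_N) : state := fun i => (x i + (i == m))%N.

Lemma throw_same x m : throw x m m = (x m).+1.
Proof. by rewrite /throw eqxx addn1. Qed.

Lemma throw_other x m i : m != i -> throw x m i = x i.
Proof. by rewrite /throw eq_sym => /negPf ->; rewrite addn0. Qed.

(** The expectation of [f] after [n] throws with cell weights [w], restricted to
the paths whose state satisfies [alive j] before the throw number [j + 1]. The
recursion peels off the last throw, so that a one-step estimate can be applied
pointwise under the remaining expectation. The weights need not sum to 1. *)
Fixpoint killed_exp w alive n f : R :=
  if n is j.+1 then
    killed_exp w alive j
      (fun x => if alive j x then \sum_m w m * f (throw x m) else 0)
  else f (fun=> 0%N).

Definition never_killed : nat -> pred state := fun _ _ => true.

Definition throw_exp w := killed_exp w never_killed.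

Lemma throw_expS w n f :
  throw_exp w n.+1 f = throw_exp w n (fun x => \sum_m w m * f (throw x m)).
Proof. by []. Qed.

Lemma killed_expD w alive n f g :
  killed_exp w alive n (fun x => f x + g x) =
  killed_exp w alive n f + killed_exp w alive n g.
Proof.
elim: n f g => [//|n IH] f g /=; rewrite -IH; congr killed_exp.
apply/funext => x; case: ifP => _; last by rewrite addr0.
by rewrite -big_split; apply: eq_bigr => m _; rewrite mulrDr.
Qed.

Lemma killed_expZ w alive n (a : R) f :
  killed_exp w alive n (fun x => a * f x) = a * killed_exp w alive n f.
Proof.
elim: n f => [//|n IH] f /=; rewrite -IH; congr killed_exp.
apply/funext => x; case: ifP => _; last by rewrite mulr0.
by rewrite mulr_sumr; apply: eq_bigr => m _; rewrite mulrCA.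
Qed.

Lemma killed_expB w alive n f g :
  killed_exp w alive n (fun x => f x - g x) =
  killed_exp w alive n f - killed_exp w alive n g.
Proof.
have -> : (fun x => f x - g x) = (fun x => f x + (-1) * g x).
  by apply/funext => x; rewrite mulN1r.
by rewrite killed_expD killed_expZ mulN1r.
Qed.

Lemma killed_exp_sum (I : finType) w alive n (F : I -> state -> R) :
  killed_exp w alive n (fun x => \sum_i F i x) =
  \sum_i killed_exp w alive n (F i).
Proof.
elim: n F => [//|n IH] F /=; rewrite -IH; congr killed_exp.
apply/funext => x; case: ifP => _; last by rewrite big1.
by rewrite exchange_big; apply: eq_bigr => m _; rewrite mulr_sumr.
Qed.

(** Functions need to be compared only on reachable states, which [I] is allowed
to overestimate. *)
Lemma ler_killed_exp_inv (I : nat -> state -> Prop) w alive n f g :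
  (forall m, 0 <= w m) -> I 0%N (fun=> 0%N) ->
  (forall j x m, I j x -> w m != 0 -> I j.+1 (throw x m)) ->
  (forall x, I n x -> f x <= g x) ->
  killed_exp w alive n f <= killed_exp w alive n g.
Proof.
move=> w0 I0 IS; elim: n f g => [|n IH] f g fg /=; first exact: fg.
apply: IH => x Ix; case: ifP => // _; apply: ler_sum => m _.
have [->|wm] := eqVneq (w m) 0; first by rewrite !mul0r.
by rewrite ler_wpM2l// fg//; exact: IS.
Qed.

Lemma sum_throw (F : nat -> R) x m :
  \sum_i F (throw x m i) = \sum_i F (x i) + (F (x m).+1 - F (x m)).
Proof.
rewrite (bigD1 m)//= [in RHS](bigD1 m)//= /throw eqxx addn1.
rewrite (eq_bigr (fun i => F (x i))); first by ring.
by move=> i /negPf ->; rewrite addn0.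
Qed.

Lemma total_throw x m : (\sum_i throw x m i)%N = (\sum_i x i).+1%N.
Proof.
rewrite /throw big_split /= -addn1; congr addn.
by rewrite (bigD1 m)//= eqxx big1 ?addn0// => i /negPf ->.
Qed.

Lemma ler_killed_exp w alive n f g : (forall m, 0 <= w m) ->
  (forall x, (\sum_i x i)%N = n -> f x <= g x) ->
  killed_exp w alive n f <= killed_exp w alive n g.
Proof.
move=> w0; apply: (@ler_killed_exp_inv (fun n x => (\sum_i x i)%N = n)) => //.
  by rewrite big1.
by move=> j x m <- _; rewrite total_throw.
Qed.

Lemma eq_killed_exp w alive n f g : (forall m, 0 <= w m) ->
  (forall x, (\sum_i x i)%N = n -> f x = g x) ->
  killed_exp w alive n f = killed_exp w alive n g.
Proof.
by move=> w0 fg; apply/eqP; rewrite eq_le !ler_killed_exp// => x /fg ->.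
Qed.

Lemma killed_exp_ge0 w alive n f : (forall m, 0 <= w m) ->
  (forall x, 0 <= f x) -> 0 <= killed_exp w alive n f.
Proof.
move=> w0 f0; rewrite -[leLHS](mul0r (killed_exp w alive n f)) -killed_expZ.
by apply: ler_killed_exp => // x _; rewrite mul0r.
Qed.

Lemma killed_exp_le_throw_exp w alive n f : (forall m, 0 <= w m) ->
  (forall x, 0 <= f x) -> killed_exp w alive n f <= throw_exp w n f.
Proof.
move=> w0; elim: n f => [//|n IH] f f0 /=.
have s0 x : 0 <= \sum_m w m * f (throw x m).
  by apply: sumr_ge0 => m _; rewrite mulr_ge0.
apply: le_trans (IH _ _) _.
  by move=> x; case: ifP.
by apply: ler_killed_exp => // x _ /=; case: ifP.
Qed.

Lemma throw_exp1 w n : (forall m, 0 <= w m) -> \sum_m w m = 1 ->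
  throw_exp w n (fun=> 1) = 1.
Proof.
move=> w0 w1; elim: n => [//|n IH]; rewrite throw_expS -[RHS]IH.
by congr killed_exp; apply/funext => x; under eq_bigr do rewrite mulr1.
Qed.

(** Union bound over the time at which a path is dropped. *)
Lemma throw_exp_le_killed_exp w alive n f :
  (forall m, 0 <= w m) -> \sum_m w m = 1 -> (forall x, 0 <= f x <= 1) ->
  throw_exp w n f <= killed_exp w alive n f +
    \sum_(j < n) throw_exp w j (fun x => (~~ alive j x)%:R).
Proof.
move=> w0 w1; elim: n f => [|n IH] f f01; first by rewrite big_ord0 addr0.
rewrite throw_expS big_ord_recr /=.
set Pf := fun x => \sum_m w m * f (throw x m).
have Pf01 x : 0 <= Pf x <= 1.
  rewrite sumr_ge0/= => [|m _]; last by rewrite mulr_ge0//; case/andP: (f01 (throw x m)).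
  rewrite -w1 ler_sum// => m _; rewrite ler_piMr//; by case/andP: (f01 (throw x m)).
have -> : throw_exp w n Pf = throw_exp w n (fun x => if alive n x then Pf x else 0)
   + throw_exp w n (fun x => if alive n x then 0 else Pf x).
  by rewrite -killed_expD; congr killed_exp; apply/funext => x; case: ifP => _; rewrite ?addr0 ?add0r.
rewrite addrA; apply: lerD; first by apply: IH => x; case: ifP => _; rewrite ?lexx ?ler01.
by apply: ler_killed_exp => // x _; case: (alive n x) => //=; case/andP: (Pf01 x).
Qed.

End sequential_throws.

(** * The multinomial law as a sequence of throws *)

Section multinomial_as_throws.
Context {R : realType} {N : nat}.
Implicit Types (p : 'I_N -> R).

Definition multinomial_weight p n (x : 'I_N -> nat) : R :=
  n`!%:R / (\prod_(m < N) (x m)`!%:R) * \prod_(m < N) p m ^+ x m.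

Lemma multinomial_weight_throw p n x m :
  (x m).+1%:R * multinomial_weight p n.+1 (throw x m) =
  n.+1%:R * (p m * multinomial_weight p n x).
Proof.
have e i : i != m -> throw x m i = x i by rewrite /throw => /negPf ->; rewrite addn0.
have fE (F : nat -> R) (y : 'I_N -> nat) :
    \prod_i F (y i) = F (y m) * \prod_(i | i != m) F (y i) by rewrite (bigD1 m).
have pE (y : 'I_N -> nat) :
    \prod_i p i ^+ y i = p m ^+ y m * \prod_(i | i != m) p i ^+ y i by rewrite (bigD1 m).
rewrite /multinomial_weight !(fE (fun k => k`!%:R)) !pE.
rewrite (eq_bigr (fun i => (x i)`!%:R)) => [|i /e ->//].
rewrite [X in _ * (_ * (_ * X)) = _](eq_bigr (fun i => p i ^+ x i)) => [|i /e ->//].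
rewrite /throw eqxx addn1 !factS exprS !natrM.
have : \prod_(i < N | i != m) (x i)`!%:R != 0 :> R.
  by rewrite prodf_seq_neq0; apply/allP => i _; rewrite pnatr_eq0 -lt0n fact_gt0 implybT.
move: (\prod_(i < N | i != m) _) (\prod_(i < N | i != m) _) => a b a0.
have f0 : (x m)`!%:R != 0 :> R by rewrite pnatr_eq0 -lt0n fact_gt0.
have s0 : (x m).+1%:R != 0 :> R by rewrite pnatr_eq0.
move: (_.+1%:R) s0 ((x m)`!%:R) f0 => s s0 f f0.
by field; rewrite a0 f0 s0.
Qed.

(** Weighting [eta] by [eta m / (n + 1)] and summing over [m] amounts to choosing
the cell of the last ball; removing that ball turns the multinomial coefficient of
[n + 1] balls into that of [n]. The bound [B] on the counts stays fixed, so that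
the induction on [n] takes place inside one finite type. *)
Lemma sum_multinomial_weight p (B n : nat) (F : ('I_N -> nat) -> R) : (n <= B)%N ->
  \sum_(eta : {ffun 'I_N -> 'I_B.+1} | (\sum_(m < N) eta m)%N == n)
     multinomial_weight p n (fun i => eta i) * F (fun i => eta i) =
  throw_exp p n F.
Proof.
elim: n F => [|n IH] F nB.
  rewrite (big_pred1 [ffun=> ord0]) => [|eta /=].
    have -> : (fun i => [ffun=> ord0 : 'I_B.+1] i : nat) = (fun=> 0%N) :> ('I_N -> nat).
      by apply/funext => i; rewrite ffunE.
    by rewrite /throw_exp /multinomial_weight !big1// ?divr1 ?mul1r.
  rewrite sum_nat_eq0; apply/forallP/eqP => [h|-> i]; last by rewrite ffunE.
  by apply/ffunP => i; rewrite ffunE; apply/val_inj/eqP; exact: h.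
rewrite throw_expS -IH; last exact: ltnW.
pose T := {ffun 'I_N -> 'I_B.+1}.
have n0 : n.+1%:R != 0 :> R by rewrite pnatr_eq0.
transitivity (\sum_(eta : T | (\sum_(m < N) eta m)%N == n.+1)
   \sum_(m < N) n.+1%:R^-1 * ((eta m)%:R * (multinomial_weight p n.+1 (fun i => eta i)
      * F (fun i => eta i)))).
  apply: eq_bigr => eta /eqP s; rewrite -mulr_sumr -mulr_suml -natr_sum s.
  by rewrite mulrA mulVf ?mul1r.
rewrite exchange_big /=.
under [RHS]eq_bigr do rewrite mulr_sumr.
rewrite [RHS]exchange_big /=; apply: eq_bigr => m _.
rewrite (bigID (fun eta : T => eta m == 0%N :> nat)) /= big1 ?add0r => [|eta /andP[_ /eqP ->]]; last first.
  by rewrite mul0r mulr0.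
pose h (z : T) : T := [ffun i => inord (z i + (i == m))%N].
pose h' (z : T) : T := [ffun i => inord (z i - (i == m))%N].
have valh (z : T) : (z m < B)%N -> (fun i => h z i : nat) = throw (fun i => z i : nat) m.
  move=> zm; apply/funext => i; rewrite ffunE inordK// /throw.
  by have [->|_] := eqVneq i m; rewrite ?addn1 ?addn0.
rewrite (reindex_onto h h') => [|eta /andP[_ em]]; last first.
  apply/ffunP => i; rewrite !ffunE inordK; last first.
    by rewrite (leq_ltn_trans (leq_subr _ _)).
  have [->|_] := eqVneq i m; last by rewrite subn0 addn0 inord_val.
  by rewrite subnK ?lt0n// inord_val.
apply: eq_big => [z|z /andP[/andP[_ hm] _]]; last first.
  have zm : (z m < B)%N.
    rewrite ltn_neqAle -ltnS ltn_ord andbT; apply: contraNneq hm => zB.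
    by rewrite ffunE eqxx zB addn1 /inord /insubd insubF//= ltnn.
  have -> : h z m = (z m).+1 :> nat.
    by have /(congr1 (@^~ m)) := valh z zm; rewrite /throw eqxx addn1.
  rewrite valh// (mulrA (_.+1%:R)) multinomial_weight_throw.
  by move: (multinomial_weight p n _) => W; rewrite -!mulrA (mulKf n0) mulrCA.
apply/idP/eqP => [/andP[/andP[/eqP s hm] _]|s].
  have zm : (z m < B)%N.
    rewrite ltn_neqAle -ltnS ltn_ord andbT; apply: contraNneq hm => zB.
    by rewrite ffunE eqxx zB addn1 /inord /insubd insubF//= ltnn.
  move: s; have := congr1 (fun x : 'I_N -> nat => (\sum_i x i)%N) (valh z zm).
  by rewrite /= total_throw => -> [].
have zm : (z m < B)%N.
  by rewrite (leq_ltn_trans _ nB)// -s (bigD1 m)//= leq_addr.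
apply/andP; split; first (apply/andP; split).
- have := congr1 (fun x : 'I_N -> nat => (\sum_i x i)%N) (valh z zm).
  by rewrite /= total_throw s => ->.
- by have := congr1 (fun x : 'I_N -> nat => x m) (valh z zm) => /= ->; rewrite /throw eqxx addn1.
- apply/eqP/ffunP => i; rewrite ffunE.
  have := congr1 (fun x : 'I_N -> nat => x i) (valh z zm) => /= ->.
  by rewrite /throw addnK inord_val.
Qed.

Lemma multinomial_probE p n (A : pred ('I_N -> nat)) :
  multinomial_prob p (fun eta : {ffun 'I_N -> 'I_n.+1} => A (fun i => eta i)) =
  throw_exp p n (fun x => (A x)%:R).
Proof.
rewrite -(@sum_multinomial_weight p n n)// /multinomial_prob /multinomial_pmf.
rewrite [LHS]big_mkcond [RHS]big_mkcond; apply: eq_bigr => eta _ /=.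
by case: (A _); case: ifP => _; rewrite ?mulr1 ?mulr0.
Qed.

End multinomial_as_throws.

(** * The pair-count martingale *)

Section pair_martingale.
Context {R : realType} {N : nat}.
Local Notation state := ('I_N -> nat).
Local Notation unif := (@uniform_cells R N).
Implicit Types (x : state) (m : 'I_N).

Definition pairs x : R := \sum_i (x i)%:R * ((x i)%:R - 1).

(** The count of ordered pairs of balls sharing a cell, centred at its mean.
Pairs are preferred to squares because a throw then changes the count linearly
([excess_throw]). *)
Definition excess (j : nat) x : R := pairs x - j%:R * (j%:R - 1) / N%:R.

(** Untruncated, the exponential moments of the excess are dominated by states
with one very full cell; [tame] keeps the increments of the excess below [2 L].
Only an upper bound is imposed: a cell lies below its mean by at most [j / N]. *)
Definition tame (L : R) (j : nat) : pred state :=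
  fun x => [forall m, (x m)%:R <= j%:R / N%:R + L].

Lemma pairs_throw x m : pairs (throw x m) = pairs x + 2 * (x m)%:R.
Proof.
rewrite /pairs (sum_throw (fun k => k%:R * (k%:R - 1))) -natr1; ring.
Qed.

Lemma sum_natr_state x j : (\sum_i x i)%N = j -> \sum_i (x i)%:R = j%:R :> R.
Proof. by move=> <-; rewrite natr_sum. Qed.

Lemma sum_sqr_state x : \sum_i (x i)%:R ^+ 2 = pairs x + \sum_i (x i)%:R.
Proof. by rewrite /pairs -big_split; apply: eq_bigr => i _ /=; ring. Qed.

Hypothesis N0 : (0 < N)%N.
Let Nn0 : N%:R != 0 :> R. Proof. by rewrite pnatr_eq0 -lt0n. Qed.
Let Np : 0 < N%:R :> R. Proof. by rewrite ltr0n. Qed.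

Lemma unif_ge0 m : 0 <= unif m. Proof. by rewrite /uniform_cells invr_ge0. Qed.

Lemma sum_unif : \sum_m unif m = 1.
Proof. by rewrite sumr_const card_ord -[LHS]mulr_natr mulVf. Qed.

#[local] Hint Resolve unif_ge0 sum_unif : core.

Lemma excess0 : excess 0 (fun=> 0%N) = 0.
Proof. by rewrite /excess /pairs big1 ?mul0r ?subr0// => i _; rewrite mul0r. Qed.

Lemma excess_throw j x m :
  excess j.+1 (throw x m) = excess j x + 2 * ((x m)%:R - j%:R / N%:R).
Proof. by rewrite /excess pairs_throw -natr1; field. Qed.

Lemma sum_dev x j : (\sum_i x i)%N = j ->
  \sum_m ((x m)%:R - j%:R / N%:R) = 0 :> R.
Proof.
move=> /sum_natr_state s; rewrite big_split /= s sumr_const card_ord -mulr_natl.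
by field.
Qed.

(** The conditional variance of the next increment is, up to the factor 4, an
affine function of the excess. This is what closes the recursion for the
generating function. *)
Lemma mean_sqr_dev x j : (\sum_i x i)%N = j ->
  N%:R^-1 * \sum_m ((x m)%:R - j%:R / N%:R) ^+ 2 =
  (excess j x + j%:R) / N%:R - j%:R / N%:R ^+ 2.
Proof.
move=> /sum_natr_state s.
have -> : \sum_m ((x m)%:R - j%:R / N%:R : R) ^+ 2 =
    \sum_m (x m)%:R ^+ 2 - 2 * (j%:R / N%:R) * \sum_m (x m)%:R
    + N%:R * (j%:R / N%:R) ^+ 2.
  have -> : N%:R * (j%:R / N%:R) ^+ 2 = \sum_(m < N) (j%:R / N%:R) ^+ 2 :> R.
    by rewrite sumr_const card_ord -[RHS]mulr_natl.
  by rewrite mulr_sumr -sumrB -big_split; apply: eq_bigr => i _ /=; ring.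
by rewrite sum_sqr_state s /excess; field.
Qed.

Lemma mean_sqr_dev_ge0 x j : 0 <= N%:R^-1 * \sum_m ((x m)%:R - j%:R / N%:R : R) ^+ 2.
Proof. by rewrite mulr_ge0 ?invr_ge0// sumr_ge0// => i _; exact: sqr_ge0. Qed.

Lemma mean_expR_excess (t : R) x j :
  \sum_m unif m * expR (t * excess j.+1 (throw x m)) =
  expR (t * excess j x) *
    \sum_m N%:R^-1 * expR (2 * t * ((x m)%:R - j%:R / N%:R)).
Proof.
rewrite mulr_sumr; apply: eq_bigr => m _.
by rewrite excess_throw mulrCA -expRD; congr (_ * expR _); ring.
Qed.

Section moment_generating_function.
Variables (d th L : R).
Hypotheses (d01 : 0 <= d <= 1) (th0 : 0 <= th) (thL : 4 * th * L <= d) (L0 : 0 <= L).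

(** The excess occurring in the conditional variance is absorbed by raising the
tilt from [t] to [t + K / N] with [K = 2 (1 + d)^3 th^2]. *)
Lemma killed_mgf_le_step (t : R) j x :
  (\sum_i x i)%N = j -> tame L j x -> 0 <= t <= (1 + d) * th ->
  \sum_m unif m * expR (t * excess j.+1 (throw x m)) <=
  expR (2 * (1 + d) ^+ 3 * th ^+ 2 * j%:R / N%:R) *
  expR ((t + 2 * (1 + d) ^+ 3 * th ^+ 2 / N%:R) * excess j x).
Proof.
move=> s /forallP al /andP[t0 tth]; have /andP[d0 d1] := d01.
rewrite mean_expR_excess -expRD.
apply: le_trans (ler_wpM2l (expR_ge0 _) (mean_expR_le N0 d01 _ _)) _.
- by rewrite -mulr_sumr sum_dev// mulr0.
- move=> m; apply: le_trans thL.
  have := al m; rewrite -lerBlDl => xm.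
  have : 2 * t * ((x m)%:R - j%:R / N%:R) <= 2 * t * L by rewrite ler_wpM2l// mulr_ge0.
  move=> /le_trans; apply; rewrite ler_wpM2r//; nra.
rewrite -expRD ler_expR.
under eq_bigr do rewrite exprMn.
rewrite -mulr_sumr (mulrCA N%:R^-1).
set V := N%:R^-1 * _; have V0 : 0 <= V by exact: mean_sqr_dev_ge0.
have VE : V <= (excess j x + j%:R) / N%:R.
  rewrite /V mean_sqr_dev// gerBl divr_ge0// exprn_ge0//.
have t2 : t ^+ 2 <= ((1 + d) * th) ^+ 2 by rewrite lerXn2r ?nnegrE// mulr_ge0//; lra.
set K := 2 * (1 + d) ^+ 3 * th ^+ 2.
have K0 : 0 <= K by rewrite /K mulr_ge0 ?sqr_ge0// mulr_ge0// exprn_ge0//; lra.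
have h : (1 + d) / 2 * ((2 * t) ^+ 2 * V) <= K * V.
  rewrite mulrA ler_wpM2r// /K.
  have -> : (1 + d) / 2 * (2 * t) ^+ 2 = 2 * (1 + d) * t ^+ 2 by field.
  have -> : 2 * (1 + d) ^+ 3 * th ^+ 2 = 2 * (1 + d) * ((1 + d) * th) ^+ 2 by ring.
  rewrite ler_wpM2l//; lra.
have h2 : K * V <= K * ((excess j x + j%:R) / N%:R) by rewrite ler_wpM2l.
have -> : K * j%:R / N%:R + (t + K / N%:R) * excess j x =
  t * excess j x + K * ((excess j x + j%:R) / N%:R) by field.
by rewrite lerD2l (le_trans h h2).
Qed.

(** The tilt drifts by at most [K n / N] over all the throws, which is small
against [th] when [th n / N] is small; hence [K] can be frozen at the largest
tilt. The deterministic parts [K j / N] then add up to [K j^2 / (2 N)]. *)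
Lemma killed_mgf_le (j : nat) (t : R) : 0 <= t ->
  t + 2 * (1 + d) ^+ 3 * th ^+ 2 * j%:R / N%:R <= (1 + d) * th ->
  killed_exp unif (tame L) j (fun x => expR (t * excess j x))
    <= expR (2 * (1 + d) ^+ 3 * th ^+ 2 * j%:R ^+ 2 / (2 * N%:R)).
Proof.
have /andP[d0 d1] := d01.
set K := 2 * (1 + d) ^+ 3 * th ^+ 2.
have K0 : 0 <= K by rewrite /K mulr_ge0 ?sqr_ge0// mulr_ge0// exprn_ge0//; lra.
elim: j t => [|j IH] t t0 tK.
  by rewrite /= excess0 mulr0 expr0n /= mulr0 mul0r.
have KN0 : 0 <= K / N%:R by rewrite divr_ge0.
have KjN0 : 0 <= K * j%:R / N%:R by rewrite divr_ge0// mulr_ge0.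
rewrite /=.
apply: (@le_trans _ _ (killed_exp unif (tame L) j
   (fun x => expR (K * j%:R / N%:R) * expR ((t + K / N%:R) * excess j x)))).
  apply: ler_killed_exp => // x s; case: ifP => [al|_].
    apply: killed_mgf_le_step => //; rewrite t0 /=.
    rewrite (le_trans _ tK)// lerDl divr_ge0// mulr_ge0//.
  by rewrite mulr_ge0 ?expR_ge0.
rewrite killed_expZ.
have tK' : t + K / N%:R + K * j%:R / N%:R <= (1 + d) * th.
  by rewrite (le_trans _ tK)// -[j.+1%:R]natr1 mulrDr mulr1 mulrDl -addrA [_ / _ + _]addrC.
apply: le_trans (ler_wpM2l (expR_ge0 _) (IH _ _ tK')) _; first exact: addr_ge0.
rewrite -expRD ler_expR -[j.+1%:R]natr1.
have -> : K * (j%:R + 1) ^+ 2 / (2 * N%:R) =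
  K * j%:R / N%:R + K * j%:R ^+ 2 / (2 * N%:R) + K / (2 * N%:R) by field.
by rewrite lerDl divr_ge0// mulr_ge0.
Qed.

Lemma killed_mgf_ge_step (t : R) j x :
  (\sum_i x i)%N = j -> tame L j x -> j%:R / N%:R <= L -> th <= t <= 2 * th ->
  expR (2 * (1 - d) ^+ 2 * th ^+ 2 * (N%:R^-1 - N%:R ^- 2) * j%:R) *
  expR ((t + 2 * (1 - d) ^+ 2 * th ^+ 2 / N%:R) * excess j x) <=
  \sum_m unif m * expR (t * excess j.+1 (throw x m)).
Proof.
move=> s /forallP al jL /andP[tht tth]; have /andP[d0 d1] := d01.
have t0 : 0 <= t by exact: le_trans tht.
rewrite mean_expR_excess -expRD.
apply: le_trans (ler_wpM2l (expR_ge0 _) (mean_expR_ge N0 d01 _ _)); first last.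
- move=> m; apply: le_trans thL.
  rewrite normrM ger0_norm ?mulr_ge0//.
  have : `|(x m)%:R - j%:R / N%:R| <= L.
    rewrite ler_norml; have := al m; have : 0 <= (x m)%:R :> R by [].
    move: jL; move: (j%:R / N%:R) => q; lra.
  move=> xL; have : 2 * t * `|(x m)%:R - j%:R / N%:R| <= 2 * t * L by rewrite ler_wpM2l// mulr_ge0.
  move=> /le_trans; apply; rewrite ler_wpM2r//; nra.
- by rewrite -mulr_sumr sum_dev// mulr0.
rewrite -expRD ler_expR.
under eq_bigr do rewrite exprMn.
rewrite -mulr_sumr (mulrCA N%:R^-1).
set V := N%:R^-1 * _; have V0 : 0 <= V by exact: mean_sqr_dev_ge0.
have VE : V = (excess j x + j%:R) / N%:R - j%:R / N%:R ^+ 2 by rewrite /V mean_sqr_dev.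
have t2 : th ^+ 2 <= t ^+ 2 by rewrite lerXn2r ?nnegrE.
set K := 2 * (1 - d) ^+ 2 * th ^+ 2.
have h : K * V <= (1 - d) ^+ 2 / 2 * ((2 * t) ^+ 2 * V).
  rewrite [leRHS]mulrA ler_wpM2r// /K.
  have -> : (1 - d) ^+ 2 / 2 * (2 * t) ^+ 2 = 2 * (1 - d) ^+ 2 * t ^+ 2 by field.
  by rewrite ler_wpM2l// mulr_ge0// sqr_ge0.
have -> : K * (N%:R^-1 - N%:R ^- 2) * j%:R + (t + K / N%:R) * excess j x =
  t * excess j x + K * V by rewrite VE; field.
by rewrite lerD2l.
Qed.

(** The same recursion from below. The paths dropped at one time contribute at
most [l]; as the accumulated exponential factors are at least 1, the total loss is
at most [j l] in proportion. *)
Lemma killed_mgf_ge (n : nat) (l : R) : 0 <= l -> n%:R / N%:R <= L ->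
  (forall j (t : R), (j < n)%N -> th <= t <= 2 * th ->
     killed_exp unif (tame L) j
       (fun x => (~~ tame L j x)%:R * expR (t * excess j x)) <= l) ->
  forall (j : nat) (t : R), (j <= n)%N -> th <= t ->
  t + 2 * (1 - d) ^+ 2 * th ^+ 2 * j%:R / N%:R <= 2 * th ->
  expR (2 * (1 - d) ^+ 2 * th ^+ 2 * (N%:R^-1 - N%:R ^- 2) * (j%:R * (j%:R - 1) / 2))
    * (1 - j%:R * l) <=
  killed_exp unif (tame L) j (fun x => expR (t * excess j x)).
Proof.
move=> l0 nL dead; have /andP[d0 d1] := d01.
set K := 2 * (1 - d) ^+ 2 * th ^+ 2; set b := N%:R^-1 - _.
have K0 : 0 <= K by rewrite /K mulr_ge0 ?sqr_ge0// mulr_ge0// sqr_ge0.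
have b0 : 0 <= b.
  rewrite /b -exprVn subr_ge0 expr2 ler_piMr ?invr_ge0// invf_le1//.
  by rewrite ler1n.
have KN0 : 0 <= K / N%:R by rewrite divr_ge0.
elim=> [|j IH] t jn tht tK.
  by rewrite /= !mul0r mulr0 excess0 mulr0 subr0 mulr1.
have jL : j%:R / N%:R <= L.
  by rewrite (le_trans _ nL)// ler_wpM2r ?invr_ge0// ler_nat ltnW.
have KjN0 : 0 <= K * j%:R / N%:R by rewrite divr_ge0// mulr_ge0.
have tK' : t + K / N%:R + K * j%:R / N%:R <= 2 * th.
  by rewrite (le_trans _ tK)// -[j.+1%:R]natr1 mulrDr mulr1 mulrDl -addrA [_ / _ + _]addrC.
rewrite /=.
apply: (@le_trans _ _ (killed_exp unif (tame L) j
   (fun x => expR (K * b * j%:R) * (expR ((t + K / N%:R) * excess j x)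
      - (~~ tame L j x)%:R * expR ((t + K / N%:R) * excess j x))))); last first.
  apply: ler_killed_exp => // x s; case: ifP => [al|_] /=; last first.
    by rewrite mul1r subrr mulr0.
  by rewrite mul0r subr0 killed_mgf_ge_step// tht/= (le_trans _ tK')// -addrA lerDl addr_ge0.
rewrite killed_expZ killed_expB.
have tt : th <= t + K / N%:R by rewrite (le_trans tht)// lerDl.
have Hdead : killed_exp unif (tame L) j
  (fun x => (~~ tame L j x)%:R * expR ((t + K / N%:R) * excess j x)) <= l.
  by apply: dead => //; rewrite tt /= (le_trans _ tK')// lerDl.
have Hj := IH _ (ltnW jn) tt tK'.
have -> : K * b * (j.+1%:R * (j.+1%:R - 1) / 2) =
  K * b * j%:R + K * b * (j%:R * (j%:R - 1) / 2) by rewrite -[j.+1%:R]natr1; field.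
rewrite expRD -mulrA ler_wpM2l ?expR_ge0//.
apply: (le_trans _ (lerB Hj Hdead)).
rewrite -[j.+1%:R]natr1 mulrDl mul1r opprD addrA mulrDr lerD2l mulrN lerN2 ler_peMl//.
rewrite -[leLHS]expR0 ler_expR mulr_ge0 ?(mulr_ge0 K0 b0)// divr_ge0//.
case: (j) => [|i]; first by rewrite mul0r.
by rewrite -[i.+1%:R]natr1 addrK mulr_ge0.
Qed.

End moment_generating_function.

Lemma throw_exp_expR_cell (j : nat) m :
  throw_exp unif j (fun x => expR (x m)%:R) <= expR (2 * j%:R / N%:R).
Proof.
elim: j => [|j IH]; first by rewrite /throw_exp /= mulr0 mul0r.
rewrite throw_expS.
have -> : (fun x => \sum_i unif i * expR (throw x i m)%:R) =
   (fun x => (1 + (expR 1 - 1) / N%:R) * expR (x m)%:R).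
  apply/funext => x; rewrite (bigD1 m)//= /throw eqxx natrD expRD.
  rewrite (eq_bigr (fun=> N%:R^-1 * expR (x m)%:R)) => [|i im]; last first.
    by rewrite eq_sym (negPf im) addn0.
  rewrite sumr_const cardC1 card_ord -[_ *+ N.-1]mulr_natl /uniform_cells.
  by rewrite (_ : N.-1%:R = N%:R - 1 :> R) -?subn1 ?natrB//; field.
rewrite /throw_exp killed_expZ.
have e3 : expR 1 <= 3 :> R.
  have := @expR_le_quadratic R 1 1; rewrite lexx ler01 => /(_ isT isT); lra.
have e1 : 1 <= expR 1 :> R by rewrite -[leLHS]expR0 ler_expR.
have h : 1 + (expR 1 - 1) / N%:R <= expR (2 / N%:R) :> R.
  apply: le_trans (expR_ge1Dx _); rewrite lerD2l ler_wpM2r ?invr_ge0//; lra.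
apply: (le_trans (ler_pM _ _ h IH)).
- by rewrite addr_ge0// divr_ge0// subr_ge0.
- by apply: killed_exp_ge0 => // x; exact: expR_ge0.
- by rewrite -expRD ler_expR -[j.+1%:R]natr1 le_eqVlt; apply/orP; left; apply/eqP; field.
Qed.

(** Markov's inequality for the exponential of the count of each cell. *)
Lemma throw_exp_untame (L : R) (j : nat) :
  throw_exp unif j (fun x => (~~ tame L j x)%:R) <= N%:R * expR (j%:R / N%:R - L).
Proof.
apply: (@le_trans _ _ (throw_exp unif j
   (fun x => \sum_m expR (- (j%:R / N%:R + L)) * expR (x m)%:R))).
  apply: ler_killed_exp => // x _.
  case: (boolP (tame L j x)) => [_|] /=.
    by apply: sumr_ge0 => m _; rewrite mulr_ge0 ?expR_ge0.
  rewrite negb_forall => /existsP[m]; rewrite -ltNge => xm.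
  rewrite (bigD1 m)//= -[leLHS]addr0 lerD//; last first.
    by apply: sumr_ge0 => i _; rewrite mulr_ge0 ?expR_ge0.
  by rewrite -expRD -[leLHS]expR0 ler_expR addrC subr_ge0 ltW.
rewrite /throw_exp killed_exp_sum.
apply: (@le_trans _ _ (\sum_(m < N) expR (- (j%:R / N%:R + L)) * expR (2 * j%:R / N%:R))).
  apply: ler_sum => m _; rewrite killed_expZ ler_wpM2l ?expR_ge0//.
  exact: throw_exp_expR_cell.
rewrite sumr_const card_ord -[leLHS]mulr_natl -expRD le_eqVlt; apply/orP; left; apply/eqP.
by congr (_ * expR _); field.
Qed.

End pair_martingale.

(** * Moderate deviations of the pair count *)

Section moderate_deviations.
Context {R : realType} {N : nat}.
Local Notation unif := (@uniform_cells R N).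

Definition excess_tail (n : nat) (b : R) : R :=
  throw_exp unif n (fun x => (b < excess n x)%R%:R).

(** [e] plays the role of the mean square deviation. All tilts used below are at
most [8 e], and [L] is chosen so that [4 (8 e) L = d], the smallness required by
the generating function bounds. As [d / (64 e) = L / 2], [untame_rare] says that
dropped paths remain negligible even after multiplication by the largest
generating function in use, [expR (512 y)] with [512 = 8 * 8^2]. *)
Variables (n : nat) (d e : R).
Hypotheses (N0 : (0 < N)%N) (n0 : (0 < n)%N) (d01 : 0 < d <= 1) (e0 : 0 < e).
Let v : R := n%:R ^+ 2 / N%:R.
Let y : R := v * e ^+ 2.
Let L : R := d / (32 * e).
Hypothesis small_load : 128 * e * (n%:R / N%:R) <= d.
Hypothesis untame_rare :
  4 * n%:R ^+ 2 * N%:R * expR (512 * y) <= expR (d / (64 * e)).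
Hypotheses (Nd : N%:R^-1 <= d) (nd : n%:R^-1 <= d).

Let Np : 0 < N%:R :> R. Proof. by rewrite ltr0n. Qed.
Let np : 0 < n%:R :> R. Proof. by rewrite ltr0n. Qed.
Let Nn0 : N%:R != 0 :> R. Proof. by rewrite gt_eqF. Qed.
Let nn0 : n%:R != 0 :> R. Proof. by rewrite gt_eqF. Qed.
Let v0 : 0 < v. Proof. by rewrite divr_gt0// exprn_gt0. Qed.
Let y0 : 0 < y. Proof. by rewrite mulr_gt0// exprn_gt0. Qed.
Let d01w : 0 <= d <= 1. Proof. by case/andP: d01 => /ltW ->. Qed.
Let L0 : 0 <= L. Proof. by case/andP: d01 => d0 _; rewrite divr_ge0 ?ltW// mulr_gt0. Qed.
#[local] Hint Resolve unif_ge0 sum_unif : core.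

Let load_le : n%:R / N%:R <= L / 2.
Proof.
rewrite /L -mulrA -invfM ler_pdivlMr; last by rewrite !mulr_gt0.
have := small_load; have : 0 <= n%:R / N%:R :> R by rewrite divr_ge0.
move: (n%:R / N%:R) => q q0; have := e0; nra.
Qed.

Let thL (th : R) : th <= 8 * e -> 4 * th * L <= d.
Proof.
move=> the; have -> : d = 4 * (8 * e) * L by rewrite /L; field; rewrite gt_eqF.
by rewrite ler_wpM2r// ler_wpM2l.
Qed.

Let cube_le : (1 + d) ^+ 3 <= 1 + 7 * d.
Proof.
case/andP: d01 => d0 d1.
have -> : (1 + d) ^+ 3 = 1 + 3 * d + 3 * d ^+ 2 + d ^+ 3 by ring.
have h1 : d ^+ 2 <= d by rewrite expr2; nra.
have h2 : d ^+ 3 <= d ^+ 2 by rewrite exprS ler_piMl// sqr_ge0.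
lra.
Qed.

Let fourth_ge : 1 - 7 * d <= (1 - d) ^+ 4.
Proof.
case/andP: d01 => d0 d1.
have -> : (1 - d) ^+ 4 = ((1 - d) ^+ 2) ^+ 2 by ring.
have : 1 - 2 * d <= (1 - d) ^+ 2 by nra.
have : 0 <= (1 - d) ^+ 2 by exact: sqr_ge0.
have : (1 - d) ^+ 2 <= 1 by nra.
move: ((1 - d) ^+ 2) => q; nra.
Qed.

Lemma tame_mgf_le (th : R) (j : nat) : 0 <= th <= 8 * e -> (j <= n)%N ->
  killed_exp unif (tame L) j (fun x => expR (th * excess j x))
    <= expR ((1 + 7 * d) * th ^+ 2 * v).
Proof.
move=> /andP[th0 the] jn; have /andP[d0 d1] := d01.
have jn' : j%:R <= n%:R :> R by rewrite ler_nat.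
apply: le_trans (killed_mgf_le N0 d01w th0 (thL the) L0 th0 _) _.
  have -> : th + 2 * (1 + d) ^+ 3 * th ^+ 2 * j%:R / N%:R =
    th + 2 * (1 + d) ^+ 3 * (th * (j%:R / N%:R)) * th by ring.
  rewrite [leRHS]mulrDl mul1r lerD2l ler_wpM2r//.
  have h1 : th * (j%:R / N%:R) <= d / 16.
    have : th * (j%:R / N%:R) <= 8 * e * (n%:R / N%:R).
      rewrite ler_pM// ?divr_ge0// ler_wpM2r// invr_ge0//.
    have := small_load; lra.
  have h0 : 0 <= th * (j%:R / N%:R) by rewrite mulr_ge0// divr_ge0.
  have h2 : 2 * (1 + d) ^+ 3 <= 16 by have := cube_le; lra.
  have h3 : 0 <= (1 + d) ^+ 3 by rewrite exprn_ge0// addr_ge0// ltW.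
  by have := ler_pM (mulr_ge0 (ler0n R 2) h3) h0 h2 h1; lra.
rewrite ler_expR /v.
have -> : 2 * (1 + d) ^+ 3 * th ^+ 2 * j%:R ^+ 2 / (2 * N%:R) =
  (1 + d) ^+ 3 * (th ^+ 2 * (j%:R ^+ 2 / N%:R)) by field.
rewrite -mulrA ler_pM ?exprn_ge0 ?mulr_ge0 ?sqr_ge0 ?invr_ge0//.
  by rewrite addr_ge0// ltW.
by rewrite ler_wpM2l ?sqr_ge0// ler_wpM2r ?invr_ge0// lerXn2r ?nnegrE.
Qed.

Let untame_le (j : nat) : (j <= n)%N ->
  4 * n%:R ^+ 2 * expR (512 * y) * throw_exp unif j (fun x => (~~ tame L j x)%:R) <= 1.
Proof.
move=> jn.
have h : throw_exp unif j (fun x => (~~ tame L j x)%:R) <= N%:R * expR (- (d / (64 * e))).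
  apply: le_trans (throw_exp_untame N0 L j) _; rewrite ler_wpM2l// ler_expR.
  have -> : d / (64 * e) = L / 2 by rewrite /L; field; rewrite gt_eqF.
  have : j%:R / N%:R <= n%:R / N%:R :> R by rewrite ler_wpM2r ?invr_ge0// ler_nat.
  have := load_le; lra.
apply: le_trans (ler_wpM2l _ h) _.
  by rewrite mulr_ge0 ?expR_ge0// mulr_ge0// sqr_ge0.
rewrite expRN mulrA ler_pdivrMr ?expR_gt0// mul1r.
by apply: le_trans untame_rare; rewrite le_eqVlt; apply/orP; left; apply/eqP; ring.
Qed.

(** Cauchy-Schwarz in additive form: the product of the indicator of dropped paths
and [exp (t W)] is at most [exp (2 t W) / (2 T) + T / 2] times that indicator,
with [T] chosen to make both terms of order [1 / n]. *)
Lemma untame_exp_le (th t : R) (j : nat) : 0 <= th <= 2 * e -> (j < n)%N ->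
  th <= t <= 2 * th ->
  killed_exp unif (tame L) j
    (fun x => (~~ tame L j x)%:R * expR (t * excess j x)) <= (2 * n%:R)^-1.
Proof.
move=> /andP[th0 the] jn /andP[tht tth].
set T := 2 * n%:R * expR (512 * y).
have T0 : 0 < T by rewrite mulr_gt0 ?expR_gt0// mulr_gt0.
have /andP[d0 d1] := d01.
have U : killed_exp unif (tame L) j (fun x => expR (2 * t * excess j x)) <= expR (512 * y).
  apply: le_trans (tame_mgf_le _ (ltnW jn)) _.
    by apply/andP; split; lra.
  rewrite ler_expR /y.
  have -> : 512 * (v * e ^+ 2) = 8 * (8 * e) ^+ 2 * v by ring.
  rewrite ler_wpM2r ?(ltW v0)// ler_pM ?sqr_ge0//; [lra|lra|].
  by rewrite lerXn2r ?nnegrE; lra.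
apply: (@le_trans _ _ (killed_exp unif (tame L) j
  (fun x => (2 * T)^-1 * expR (2 * t * excess j x) + T / 2 * (~~ tame L j x)%:R))).
  apply: ler_killed_exp => // x _.
  case: (tame L j x) => /=; first by rewrite mul0r mulr0 addr0 mulr_ge0 ?expR_ge0// invr_ge0 mulr_ge0// ltW.
  have -> : expR (2 * t * excess j x) = expR (t * excess j x) ^+ 2.
    by rewrite -expRM_natl mulrA.
  rewrite mul1r mulr1.
  have -> : (2 * T)^-1 * expR (t * excess j x) ^+ 2 + T / 2 =
    expR (t * excess j x) + (expR (t * excess j x) - T) ^+ 2 / (2 * T).
    by field; rewrite gt_eqF.
  by rewrite lerDl divr_ge0 ?sqr_ge0// mulr_ge0// ltW.
rewrite killed_expD !killed_expZ.
have -> : (2 * n%:R)^-1 = (2 * T)^-1 * expR (512 * y) + (4 * n%:R)^-1 :> R.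
  by rewrite /T; field; rewrite expR_eq0 nn0.
apply: lerD; first by rewrite ler_wpM2l// invr_ge0 mulr_ge0// ltW.
have h := untame_le (ltnW jn).
have h2 : killed_exp unif (tame L) j (fun x => (~~ tame L j x)%:R) <=
   throw_exp unif j (fun x => (~~ tame L j x)%:R).
  by apply: killed_exp_le_throw_exp.
apply: le_trans (ler_wpM2l _ h2) _; first by rewrite divr_ge0// ltW.
rewrite -[leRHS]mul1r ler_pdivlMr ?mulr_gt0//; apply: le_trans h.
by rewrite le_eqVlt; apply/orP; left; apply/eqP; rewrite /T; field.
Qed.

Lemma tame_mgf_ge (th : R) : 0 <= th <= 2 * e ->
  2^-1 * expR ((1 - 7 * d) * th ^+ 2 * v) <=
  killed_exp unif (tame L) n (fun x => expR (th * excess n x)).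
Proof.
move=> the'; have /andP[th0 the] := the'; have /andP[d0 d1] := d01.
have nL : n%:R / N%:R <= L by have := load_le; have := L0; lra.
have th8 : th <= 8 * e by have := e0; lra.
have l0 : 0 <= (2 * n%:R)^-1 :> R by rewrite invr_ge0 mulr_ge0.
have H := killed_mgf_ge N0 d01w th0 (thL th8) L0 l0 nL
  (fun j t jn tth => untame_exp_le the' jn tth) (leqnn n) (lexx th).
apply: le_trans (H _); last first.
  have h1 : 2 * (1 - d) ^+ 2 * (th * (n%:R / N%:R)) <= 1.
    have q0 : 0 <= n%:R / N%:R :> R by rewrite divr_ge0.
    have a1 : th * (n%:R / N%:R) <= 2^-1.
      apply: le_trans (ler_wpM2r q0 the) _.
      have := small_load; move: q0; move: (n%:R / N%:R) => q q0; nra.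
    have a2 : (1 - d) ^+ 2 <= 1 by nra.
    have a3 : 0 <= th * (n%:R / N%:R) by rewrite mulr_ge0.
    have := ler_pM (sqr_ge0 _) a3 a2 a1; lra.
  have -> : th + 2 * (1 - d) ^+ 2 * th ^+ 2 * n%:R / N%:R =
    th + th * (2 * (1 - d) ^+ 2 * (th * (n%:R / N%:R))) by ring.
  by have := ler_wpM2l th0 h1; lra.
rewrite [leRHS]mulrC; have -> : 1 - n%:R * (2 * n%:R)^-1 = 2^-1 :> R by field.
rewrite ler_wpM2l ?invr_ge0// ler_expR.
have -> : 2 * (1 - d) ^+ 2 * th ^+ 2 * (N%:R^-1 - N%:R ^- 2) *
    (n%:R * (n%:R - 1) / 2) =
    (1 - d) ^+ 2 * ((1 - N%:R^-1) * (1 - n%:R^-1)) * (th ^+ 2 * v).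
  by rewrite /v; field; rewrite nn0 Nn0.
rewrite -mulrA ler_wpM2r ?mulr_ge0 ?sqr_ge0 ?(ltW v0)//.
apply: le_trans fourth_ge _.
have -> : (1 - d) ^+ 4 = (1 - d) ^+ 2 * ((1 - d) * (1 - d)) by ring.
by rewrite ler_wpM2l ?sqr_ge0// ler_pM ?subr_ge0 ?lerB.
Qed.

(** Chernoff's inequality at [th = e / 2], the minimiser of
[- th v e + th^2 v]. *)
Lemma excess_tail_le (b : R) : v * e <= b ->
  excess_tail n b <= 2 * expR (- (y * (4^-1 - 2 * d))).
Proof.
move=> vb; have /andP[d0 d1] := d01.
apply: le_trans (throw_exp_le_killed_exp (tame L) n (unif_ge0 (N := N)) (sum_unif N0) _) _.
  by move=> x; case: (_ < _) => /=; rewrite ?lexx ?ler01.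
have -> (r : R) : 2 * r = r + r by ring.
apply: lerD.
  have e8 : 0 <= e / 2 <= 8 * e by have := e0; move=> ?; apply/andP; split; lra.
  apply: (@le_trans _ _ (killed_exp unif (tame L) n
      (fun x => expR (- (e / 2 * b)) * expR (e / 2 * excess n x)))).
    apply: ler_killed_exp => // x _; rewrite -expRD.
    case: ltP => [bx|_] /=; last exact: expR_ge0.
    rewrite -[leLHS]expR0 ler_expR addrC -mulrBr mulr_ge0 ?subr_ge0 ?(ltW bx)//.
    by case/andP: e8.
  rewrite killed_expZ; apply: le_trans (ler_wpM2l (expR_ge0 _) (tame_mgf_le e8 (leqnn n))) _.
  rewrite -expRD ler_expR /y.
  have := ler_wpM2l (ltW e0) vb => hb.
  have -> : (1 + 7 * d) * (e / 2) ^+ 2 * v = (1 + 7 * d) / 4 * (v * e ^+ 2) by field.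
  have -> : e / 2 * b = (e * b) / 2 by ring.
  have hy : 0 <= d * (v * e ^+ 2) by rewrite mulr_ge0 ?(ltW y0)// ltW.
  have E : e * (v * e) = v * e ^+ 2 by ring.
  rewrite E in hb; move: hb hy; move: (v * e ^+ 2) => z; lra.
apply: (@le_trans _ _ (\sum_(j < n) (4 * n%:R ^+ 2 * expR (512 * y))^-1)).
  apply: ler_sum => j _; rewrite -[leRHS]mul1r ler_pdivlMr.
    by rewrite mulrC untame_le// ltnW.
  by rewrite mulr_gt0 ?expR_gt0// mulr_gt0// exprn_gt0.
rewrite sumr_const card_ord -[leLHS]mulr_natl invfM -expRN.
have n1 : 1 <= n%:R :> R by rewrite ler1n.
have -> : n%:R * ((4 * n%:R ^+ 2)^-1 * expR (- (512 * y))) =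
   (4 * n%:R)^-1 * expR (- (512 * y)) by field.
apply: (@le_trans _ _ (expR (- (512 * y)))).
  rewrite ler_piMl ?expR_ge0// invf_le1//; lra.
rewrite ler_expR lerN2; have := y0; nra.
Qed.

(** Exponential change of measure. Under the tilt [th = (1 + 2 k) e / 2] the excess
concentrates near [(1 + 2 k) v e], inside the window from [b] to
[b' = (1 + 3 k) v e]: the parts of the tilted mass below [b] and above [b'] are
compared with the generating functions at [th - s] and [th + s], and each is at
most a quarter of the total because of the gap [k^2 y / 8] in the exponents. *)
Lemma excess_tail_ge (b k : R) : 0 < k <= 1 -> 7 * d <= k ^+ 2 / 50 ->
  8 <= expR (k ^+ 2 / 8 * y) -> b <= (1 + k) * v * e ->
  4^-1 * expR (- (y * (4^-1 + 4 * k))) <= excess_tail n b.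
Proof.
move=> /andP[k0 k1] dk k8 bv; have /andP[d0 d1] := d01.
apply: le_trans (_ : killed_exp unif (tame L) n (fun x => (b < excess n x)%R%:R) <= _);
  last exact: killed_exp_le_throw_exp.
pose th := (1 + 2 * k) / 2 * e; pose s := k / 2 * e.
pose b' := (1 + 3 * k) * v * e.
have e0' := e0.
have s0 : 0 <= s by rewrite /s mulr_ge0 ?divr_ge0// ltW.
have th_le : 0 <= th <= 2 * e by apply/andP; split; rewrite /th; nra.
have ths_le : 0 <= th - s <= 8 * e by apply/andP; split; rewrite /th /s; nra.
have ths_le' : 0 <= th + s <= 8 * e by apply/andP; split; rewrite /th /s; nra.
set M := fun t : R => killed_exp unif (tame L) n (fun x => expR (t * excess n x)).
have Mlow := tame_mgf_ge th_le; rewrite -/(M th) in Mlow.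
have Mm := tame_mgf_le ths_le (leqnn n); rewrite -/(M (th - s)) in Mm.
have Mp := tame_mgf_le ths_le' (leqnn n); rewrite -/(M (th + s)) in Mp.
set P := killed_exp unif (tame L) n (fun x => (b < excess n x)%R%:R).
have split_mgf : M th <= expR (th * b') * P + expR (s * b) * M (th - s)
    + expR (- (s * b')) * M (th + s).
  rewrite /M /P -!killed_expZ -!killed_expD; apply: ler_killed_exp => // x _.
  rewrite -!expRD; case: (ltP b (excess n x)) => bx /=.
    case: (leP (excess n x) b') => xb'.
      rewrite mulr1 -addrA ler_wpDr ?addr_ge0 ?expR_ge0// ler_expR ler_wpM2l//.
      by case/andP: th_le.
    rewrite mulr1 addrC ler_wpDr ?addr_ge0 ?expR_ge0// ler_expR.
    by have := ler_wpM2l s0 (ltW xb'); lra.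
  rewrite mulr0 add0r ler_wpDr ?expR_ge0// ler_expR.
  by have := ler_wpM2l s0 bx; lra.
have small : expR (- (k ^+ 2 / 8 * y)) <= 8^-1.
  by rewrite expRN lef_pV2 ?posrE ?expR_gt0.
have y0' := ltW y0.
have k2 : 0 <= k ^+ 2 by exact: sqr_ge0.
have kk : k ^+ 2 <= 1 by nra.
have tail_m : expR (s * b) * M (th - s) <= 4^-1 * M th.
  apply: le_trans (ler_wpM2l (expR_ge0 _) Mm) _.
  apply: (@le_trans _ _ (expR (- (k ^+ 2 / 8 * y)) * expR ((1 - 7 * d) * th ^+ 2 * v))).
    rewrite -!expRD ler_expR.
    have sb : s * b <= s * ((1 + k) * v * e) by rewrite ler_wpM2l.
    apply: le_trans (lerD sb (lexx _)) _.
    have -> : s * ((1 + k) * v * e) + (1 + 7 * d) * (th - s) ^+ 2 * v =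
      (k / 2 * (1 + k) + (1 + 7 * d) * (1 + k) ^+ 2 / 4) * y.
      by rewrite /s /th /y; field.
    have -> : - (k ^+ 2 / 8 * y) + (1 - 7 * d) * th ^+ 2 * v =
      (- (k ^+ 2 / 8) + (1 - 7 * d) * (1 + 2 * k) ^+ 2 / 4) * y.
      by rewrite /th /y; field.
    rewrite ler_wpM2r//.
    suff : 7 * d * ((1 + k) ^+ 2 + (1 + 2 * k) ^+ 2) <= k ^+ 2 / 50 * 13 by nra.
    by rewrite ler_pM//; nra.
  apply: le_trans (ler_wpM2r (expR_ge0 _) small) _.
  by move: Mlow; lra.
have tail_p : expR (- (s * b')) * M (th + s) <= 4^-1 * M th.
  apply: le_trans (ler_wpM2l (expR_ge0 _) Mp) _.
  apply: (@le_trans _ _ (expR (- (k ^+ 2 / 8 * y)) * expR ((1 - 7 * d) * th ^+ 2 * v))).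
    rewrite -!expRD ler_expR.
    have -> : - (s * b') + (1 + 7 * d) * (th + s) ^+ 2 * v =
      (- (k / 2 * (1 + 3 * k)) + (1 + 7 * d) * (1 + 3 * k) ^+ 2 / 4) * y.
      by rewrite /s /th /y /b'; field.
    have -> : - (k ^+ 2 / 8 * y) + (1 - 7 * d) * th ^+ 2 * v =
      (- (k ^+ 2 / 8) + (1 - 7 * d) * (1 + 2 * k) ^+ 2 / 4) * y.
      by rewrite /th /y; field.
    rewrite ler_wpM2r//.
    suff : 7 * d * ((1 + 3 * k) ^+ 2 + (1 + 2 * k) ^+ 2) <= k ^+ 2 / 50 * 25 by nra.
    by rewrite ler_pM//; nra.
  apply: le_trans (ler_wpM2r (expR_ge0 _) small) _.
  by move: Mlow; lra.
have half : 2^-1 * M th <= expR (th * b') * P by lra.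
have : 4^-1 * expR ((1 - 7 * d) * th ^+ 2 * v) <= expR (th * b') * P.
  by apply: le_trans half; lra.
move=> /(ler_wpM2l (expR_ge0 (- (th * b')))).
rewrite [leRHS]mulrA -expRD addNr expR0 mul1r; apply: le_trans.
rewrite [leRHS]mulrCA ler_wpM2l ?invr_ge0// -expRD ler_expR.
have -> : - (th * b') + (1 - 7 * d) * th ^+ 2 * v =
  - (y * ((1 + 2 * k) / 2 * (1 + 3 * k) - (1 - 7 * d) * (1 + 2 * k) ^+ 2 / 4)).
  by rewrite /th /b' /y; field.
rewrite lerN2 ler_wpM2l//.
have h : 7 * d * (1 + 2 * k) ^+ 2 <= k ^+ 2 / 50 * 9 by rewrite ler_pM//; nra.
have h2 : k ^+ 2 <= k by nra.
nra.
Qed.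

End moderate_deviations.

Arguments excess_tail {R} N n b.

(** * One crowded cell *)

Section crowded_cell.
Context {R : realType} {N : nat}.
Local Notation state := ('I_N -> nat).
Local Notation unif := (@uniform_cells R N).
Variable o : 'I_N.
Hypothesis N1 : (1 < N)%N.
Let N0 : (0 < N)%N. Proof. exact: ltnW. Qed.
Let M : R := N%:R - 1.
Let M0 : 0 < M. Proof. by rewrite subr_gt0 ltr1n. Qed.
Let Np : 0 < N%:R :> R. Proof. by rewrite ltr0n. Qed.
Let Nn0 : N%:R != 0 :> R. Proof. by rewrite gt_eqF. Qed.
Let Mn0 : M != 0. Proof. by rewrite gt_eqF. Qed.
Let N1n0 : N%:R - 1 != 0 :> R. Proof. exact: Mn0. Qed.

Definition avoid (m : 'I_N) : R := if m == o then 0 else M^-1.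

Definition stack (k : nat) (x : state) : state := fun i => (x i + k * (i == o))%N.

Lemma throw_expZw (c : R) w n (f : state -> R) :
  throw_exp (fun m => c * w m) n f = c ^+ n * throw_exp w n f.
Proof.
elim: n f => [|n IH] f; first by rewrite expr0 mul1r.
rewrite !throw_expS IH exprSr -mulrA; congr (_ * _).
rewrite /throw_exp -killed_expZ; congr killed_exp; apply/funext => x.
by rewrite mulr_sumr; apply: eq_bigr => m _; rewrite mulrA.
Qed.

(** Binomial theorem for the number of balls in cell [o]: the throws hitting [o]
commute with the others, and Pascal's rule performs the induction. *)
Lemma throw_exp_cell_split (n k : nat) (f : state -> R) :
  throw_exp unif n (fun x => (x o == k)%:R * f x) =
  'C(n, k)%:R / N%:R ^+ k *
    throw_exp (fun m => if m == o then 0 else N%:R^-1) (n - k) (f \o stack k).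
Proof.
pose r : 'I_N -> R := fun m => if m == o then 0 else N%:R^-1; rewrite -/r.
elim: n k f => [|n IH] k f.
  case: k => [|k]; last by rewrite bin0n /throw_exp /= !mul0r.
  by rewrite bin0 expr0 divr1 /throw_exp /= !mul1r.
rewrite throw_expS.
pose Pr (g : state -> R) x := \sum_m r m * g (throw x m).
have -> : (fun x => \sum_m unif m * ((throw x m o == k)%:R * f (throw x m))) =
   (fun x => (x o == k)%:R * Pr f x + ((x o).+1 == k)%:R * (N%:R^-1 * f (throw x o))).
  apply/funext => x; rewrite (bigD1 o)//= throw_same addrC mulrCA.
  congr (_ + _); rewrite /Pr [in RHS](bigD1 o)//= /r eqxx mul0r add0r mulr_sumr.
  apply: eq_bigr => m mo; rewrite (negPf mo) throw_other//.
  by rewrite mulrCA.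
rewrite /throw_exp killed_expD -/(throw_exp unif n) IH.
have PrE g j : throw_exp r j (Pr g) = throw_exp r j.+1 g by [].
have stackP g : Pr g \o stack k = Pr (g \o stack k).
  apply/funext => x; apply: eq_bigr => m _ /=; congr (_ * g _).
  by apply/funext => i; rewrite /throw /stack addnAC.
rewrite stackP PrE.
case: k stackP => [|k] stackP.
  rewrite bin0 bin0 subn0 -[RHS]addr0; congr (_ + _).
  by rewrite -[RHS](mul0r (throw_exp unif n f)) -killed_expZ; congr killed_exp; apply/funext => x; rewrite !mul0r.
rewrite (IH k (fun x => N%:R^-1 * f (throw x o))) subSS.
have -> : (fun x => N%:R^-1 * f (throw x o)) \o stack k = (fun x => N%:R^-1 * (f \o stack k.+1) x).
  apply/funext => x /=; congr (_ * f _).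
  by apply/funext => i; rewrite /throw /stack mulSn addnAC addnA.
rewrite /throw_exp killed_expZ -/(throw_exp r _) -/(throw_exp r _) binS natrD.
have [kn|nk] := ltnP k n; last first.
  by rewrite (bin_small (nk : (n < k.+1)%N)) mul0r mul0r !add0r exprS; field; rewrite Nn0 ?expf_neq0.
by rewrite -subSn// subSS exprS; field; rewrite Nn0 ?expf_neq0.
Qed.

Lemma avoid_ge0 m : 0 <= avoid m.
Proof. by rewrite /avoid; case: ifP => // _; rewrite invr_ge0 ltW. Qed.

Lemma sum_avoid (F : 'I_N -> R) : \sum_m avoid m * F m = M^-1 * \sum_(m | m != o) F m.
Proof.
rewrite (bigD1 o)//= {1}/avoid eqxx mul0r add0r mulr_sumr.
by apply: eq_bigr => m /negPf mo; rewrite /avoid mo.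
Qed.

Lemma sum_avoid_cst (c : R) : \sum_(m | m != o) c = M * c.
Proof. by rewrite sumr_const cardC1 card_ord /M -[LHS]mulr_natl -subn1 natrB. Qed.

Let inv (j : nat) (x : state) := (\sum_i x i)%N = j /\ x o = 0%N.

Let ler_avoid n (f g : state -> R) : (forall x, inv n x -> f x <= g x) ->
  throw_exp avoid n f <= throw_exp avoid n g.
Proof.
apply: ler_killed_exp_inv; first exact: avoid_ge0.
- by split => //; rewrite big1.
- move=> j x m [xs xo]; rewrite /avoid; have [_|mo _] := eqVneq m o; first by rewrite eqxx.
  by split; [rewrite total_throw xs | rewrite throw_other].
Qed.

Let eq_avoid n (f g : state -> R) : (forall x, inv n x -> f x = g x) ->
  throw_exp avoid n f = throw_exp avoid n g.
Proof. by move=> fg; apply/eqP; rewrite eq_le !ler_avoid// => x /fg ->. Qed.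

Let dev (j : nat) (x : state) : R := pairs x - j%:R * (j%:R - 1) / M.

Let sum_x j x : inv j x -> \sum_(m | m != o) (x m)%:R = j%:R :> R.
Proof.
by case=> xs xo; rewrite -xs natr_sum [RHS](bigD1 o)//= xo add0r.
Qed.

Let sum_x2 j x : inv j x -> \sum_(m | m != o) (x m)%:R ^+ 2 = pairs x + j%:R :> R.
Proof.
case=> xs xo; rewrite -(@sum_natr_state R _ _ _ xs) -sum_sqr_state [RHS](bigD1 o)//= xo.
by rewrite expr0n add0r.
Qed.

Let dev_throw j x m : dev j.+1 (throw x m) = dev j x + 2 * ((x m)%:R - j%:R / M).
Proof. by rewrite /dev pairs_throw -[j.+1%:R]natr1; field. Qed.

Lemma avoid_dev0 j : throw_exp avoid j (dev j) = 0.
Proof.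
elim: j => [|j IH].
  by rewrite /throw_exp /= /dev /pairs big1 ?mul0r ?subr0// => i _; rewrite mul0r.
rewrite throw_expS -[RHS]IH; apply: eq_avoid => x ix.
under eq_bigr do rewrite dev_throw.
rewrite sum_avoid.
have -> : \sum_(m | m != o) (dev j x + 2 * ((x m)%:R - j%:R / M)) =
   \sum_(m | m != o) (dev j x - 2 * (j%:R / M)) + 2 * \sum_(m | m != o) (x m)%:R.
  by rewrite mulr_sumr -big_split; apply: eq_bigr => m _ /=; ring.
by rewrite sum_avoid_cst (sum_x ix); field.
Qed.

(** Orthogonality of martingale increments; each contributes on average at most
[4 j / M]. *)
Lemma avoid_dev_sqr j : throw_exp avoid j (fun x => dev j x ^+ 2) <= 2 * j%:R ^+ 2 / M.
Proof.
elim: j => [|j IH].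
  rewrite /throw_exp /= /dev /pairs big1; last by move=> i _; rewrite mul0r.
  by rewrite !mul0r subr0 expr0n /= mulr0 mul0r.
rewrite throw_expS.
apply: (@le_trans _ _ (throw_exp avoid j (fun x => (dev j x ^+ 2 + 4 / M * dev j x) + 4 * j%:R / M * 1))).
  apply: ler_avoid => x ix.
  under eq_bigr do rewrite dev_throw.
  rewrite sum_avoid.
  have -> : \sum_(m | m != o) (dev j x + 2 * ((x m)%:R - j%:R / M)) ^+ 2 =
     \sum_(m | m != o) (dev j x - 2 * (j%:R / M)) ^+ 2
     + 4 * (dev j x - 2 * (j%:R / M)) * \sum_(m | m != o) (x m)%:R
     + 4 * \sum_(m | m != o) (x m)%:R ^+ 2.
    by rewrite !mulr_sumr -!big_split; apply: eq_bigr => m _ /=; ring.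
  rewrite sum_avoid_cst (sum_x ix) (sum_x2 ix).
  have -> : pairs x = dev j x + j%:R * (j%:R - 1) / M by rewrite /dev subrK.
  rewrite mulr1 -subr_ge0.
  have -> : dev j x ^+ 2 + 4 / M * dev j x + 4 * j%:R / M -
    M^-1 * (M * (dev j x - 2 * (j%:R / M)) ^+ 2 +
    4 * (dev j x - 2 * (j%:R / M)) * j%:R +
    4 * (dev j x + j%:R * (j%:R - 1) / M + j%:R)) = 4 * j%:R / M ^+ 2 by field.
  by rewrite divr_ge0 ?sqr_ge0// mulr_ge0.
rewrite /throw_exp !killed_expD !killed_expZ -!/(throw_exp avoid j _) avoid_dev0 mulr0 addr0.
rewrite throw_exp1; last 2 first.
- exact: avoid_ge0.
- have := sum_avoid (fun=> 1); rewrite sum_avoid_cst mulr1 mulVf// => <-.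
  by apply: eq_bigr => m _; rewrite mulr1.
apply: le_trans (lerD IH (lexx _)) _.
rewrite mulr1 -mulrDl ler_wpM2r ?invr_ge0 ?(ltW M0)// -[j.+1%:R]natr1; nra.
Qed.

(** Chebyshev's inequality. *)
Lemma avoid_pairs_ge (j : nat) (t : R) : 0 < t -> 4 * j%:R ^+ 2 <= M * t ^+ 2 ->
  2^-1 <= throw_exp avoid j
    (fun x => (j%:R * (j%:R - 1) / M - t <= pairs x)%R%:R).
Proof.
move=> t0 jt.
have t2 : 0 < t ^+ 2 by rewrite exprn_gt0.
have a1 : throw_exp avoid j (fun=> 1) = 1.
  apply: throw_exp1; first exact: avoid_ge0.
  have := sum_avoid (fun=> 1); rewrite sum_avoid_cst mulr1 mulVf// => <-.
  by apply: eq_bigr => m _; rewrite mulr1.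
have : throw_exp avoid j (fun=> 1) <= throw_exp avoid j
   (fun x => (j%:R * (j%:R - 1) / M - t <= pairs x)%R%:R + t ^- 2 * dev j x ^+ 2).
  apply: ler_avoid => x ix.
  case: (leP (j%:R * (j%:R - 1) / M - t) (pairs x)) => px /=.
    by rewrite lerDl mulr_ge0 ?sqr_ge0// invr_ge0 ltW.
  rewrite add0r mulrC ler_pdivlMr// mul1r.
  have : t < - dev j x by rewrite /dev; lra.
  by move=> td; rewrite -[leRHS]sqrrN lerXn2r ?nnegrE; lra.
rewrite a1 /throw_exp killed_expD killed_expZ -!/(throw_exp avoid j _) => h.
have h2 : t ^- 2 * throw_exp avoid j (fun x => dev j x ^+ 2) <= 2^-1.
  apply: le_trans (ler_wpM2l _ (avoid_dev_sqr j)) _; first by rewrite invr_ge0 ltW.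
  rewrite mulrC ler_pdivrMr// ler_pdivrMr//; lra.
lra.
Qed.

(** The [k] balls in cell [o] bring [k (k - 1)] pairs. The other [n - k] balls are
missing about [2 k n / N] pairs, as compared with [n] balls, and lose at most [t]
more with probability at least 1/2. *)
Lemma crowded_cell_prob (n k : nat) (b t : R) : (k <= n)%N -> 0 < t ->
  8 * (n%:R / N%:R) * n%:R <= t ^+ 2 ->
  b + t + 2 * (n%:R / N%:R) * k%:R < k%:R * (k%:R - 1) ->
  2^-1 * ('C(n, k)%:R / N%:R ^+ k * (1 - N%:R^-1) ^+ (n - k)) <= excess_tail N n b.
Proof.
move=> kn t0 nt kb.
have N2 : N%:R <= 2 * M.
  rewrite /M; have : 2 <= N%:R :> R by rewrite ler_nat.
  lra.
apply: (@le_trans _ _ (throw_exp unif n (fun x => (x o == k)%:R * (b < excess n x)%R%:R))); last first.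
  apply: ler_killed_exp => [m|x _]; first exact: unif_ge0.
  by case: (x o == k); rewrite ?mul1r// mul0r.
rewrite throw_exp_cell_split.
have -> : (fun m => if m == o then 0 else N%:R^-1) = (fun m => (1 - N%:R^-1) * avoid m).
  apply/funext => m; rewrite /avoid; case: ifP => _; first by rewrite mulr0.
  by rewrite /M; field; rewrite Nn0 N1n0.
rewrite throw_expZw [leRHS]mulrA mulrC ler_wpM2l//.
  rewrite mulr_ge0 ?divr_ge0 ?exprn_ge0//.
  by rewrite subr_ge0 invf_le1// ler1n.
have rk : (n - k)%:R = n%:R - k%:R :> R by rewrite natrB.
have h : 4 * (n - k)%:R ^+ 2 <= M * t ^+ 2.
  have h1 : (n - k)%:R ^+ 2 <= n%:R ^+ 2 :> R.
    by rewrite lerXn2r ?nnegrE// ler_nat leq_subr.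
  have h2 : M * (8 * (n%:R / N%:R) * n%:R) <= M * t ^+ 2 by rewrite ler_wpM2l// ltW.
  apply: le_trans h2; apply: le_trans (ler_wpM2l _ h1) _ => //.
  have -> : M * (8 * (n%:R / N%:R) * n%:R) = 4 * n%:R ^+ 2 * (2 * M / N%:R) by field.
  by rewrite ler_peMr ?mulr_ge0 ?sqr_ge0// ler_pdivlMr// mul1r.
apply: le_trans (avoid_pairs_ge t0 h) _; apply: ler_avoid => x [xs xo] /=.
have pE : pairs (stack k x) = pairs x + k%:R * (k%:R - 1) :> R.
  rewrite /pairs [in LHS](bigD1 o)//= [in RHS](bigD1 o)//= /stack eqxx muln1 xo add0n.
  rewrite mul0r add0r addrC; congr (_ + _).
  by apply: eq_bigr => i /negPf ->; rewrite muln0 addn0.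
have rr : (n - k)%:R * ((n - k)%:R - 1) / N%:R <= (n - k)%:R * ((n - k)%:R - 1) / M :> R.
  rewrite ler_wpM2l//; last by rewrite lef_pV2 ?posrE// /M gerBl.
  by case: (n - k)%N => [|i]; rewrite ?mul0r// -[i.+1%:R]natr1 addrK mulr_ge0// addr_ge0.
case: (leP ((n - k)%:R * ((n - k)%:R - 1) / M - t) (pairs x)) => px //=.
suff -> : (b < excess n (stack k x)) = true by [].
rewrite /excess pE.
suff : b < (n - k)%:R * ((n - k)%:R - 1) / N%:R - t + k%:R * (k%:R - 1) - n%:R * (n%:R - 1) / N%:R by lra.
rewrite rk.
have -> : (n%:R - k%:R) * (n%:R - k%:R - 1) / N%:R - t + k%:R * (k%:R - 1)
   - n%:R * (n%:R - 1) / N%:R =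
   k%:R * (k%:R - 1) - t - 2 * (n%:R / N%:R) * k%:R + (k%:R ^+ 2 + k%:R) / N%:R by field.
have : 0 <= (k%:R ^+ 2 + k%:R) / N%:R :> R by rewrite divr_ge0// addr_ge0// sqr_ge0.
lra.
Qed.

Lemma natr_ffact_ge (n k : nat) : (k <= n)%N -> (n%:R - k%:R) ^+ k <= (n ^_ k)%:R :> R.
Proof.
elim: k n => [|k IH] [|n]//; rewrite ?ffactn0 ?expr0// ltnS => kn.
rewrite ffactSS natrM exprS ler_pM ?exprn_ge0 ?subr_ge0 ?ler_nat// ?gerBl//.
rewrite (_ : n.+1%:R - k.+1%:R = n%:R - k%:R :> R) ?IH//.
by rewrite -[n.+1%:R]natr1 -[k.+1%:R]natr1; ring.
Qed.

Lemma binomial_ge (n k : nat) : (0 < k)%N -> (2 * k <= n)%N ->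
  (n%:R / (2 * k%:R)) ^+ k <= 'C(n, k)%:R :> R.
Proof.
move=> k0 kn; have kn' : (k <= n)%N by rewrite (leq_trans _ kn)// leq_pmull.
have kp : 0 < k%:R :> R by rewrite ltr0n.
have fp : 0 < k`!%:R :> R by rewrite ltr0n fact_gt0.
have -> : 'C(n, k)%:R = (n ^_ k)%:R / k`!%:R :> R.
  by rewrite -bin_ffact natrM mulfK// gt_eqF.
rewrite ler_pdivlMr//.
have fk : k`!%:R <= k%:R ^+ k :> R.
  rewrite -natrX ler_nat.
  suff H j : (j <= k)%N -> (j`! <= k ^ j)%N by exact: H.
  elim: j => [//|j IH] jk; rewrite factS expnS leq_mul// IH// ltnW//.
apply: le_trans (natr_ffact_ge kn').
apply: le_trans (ler_wpM2l _ fk) _.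
  by rewrite exprn_ge0// divr_ge0// mulr_ge0.
rewrite -exprMn; have -> : n%:R / (2 * k%:R) * k%:R = n%:R / 2 :> R by field; rewrite gt_eqF.
have kn2 : 2 * k%:R <= n%:R :> R by rewrite -natrM ler_nat.
rewrite lerXn2r ?nnegrE ?divr_ge0//; lra.
Qed.

Lemma excess_tail_ge_crowded (n k : nat) (b t : R) : (0 < k)%N -> (2 * k <= n)%N ->
  0 < t -> 8 * (n%:R / N%:R) * n%:R <= t ^+ 2 ->
  b + t + 2 * (n%:R / N%:R) * k%:R < k%:R * (k%:R - 1) ->
  2^-1 * expR (- (k%:R * ln (2 * k%:R / (n%:R / N%:R)) + 2 * (n%:R / N%:R)))
    <= excess_tail N n b.
Proof.
move=> k0 kn t0 nt kb; have kn' : (k <= n)%N by rewrite (leq_trans _ kn)// leq_pmull.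
apply: le_trans (crowded_cell_prob kn' t0 nt kb).
rewrite ler_wpM2l// opprD expRD.
have kp : 0 < k%:R :> R by rewrite ltr0n.
have np : 0 < n%:R :> R by rewrite ltr0n (leq_trans k0).
have qp : 0 < 2 * k%:R / (n%:R / N%:R) :> R by rewrite !divr_gt0// mulr_gt0.
have -> : expR (- (k%:R * ln (2 * k%:R / (n%:R / N%:R)))) =
   (n%:R / (2 * k%:R)) ^+ k / N%:R ^+ k :> R.
  rewrite expRN expRM_natl lnK ?posrE// -[LHS]exprVn -[RHS]expr_div_n; congr (_ ^+ k).
  by field; rewrite !gt_eqF.
apply: ler_pM => //.
  by rewrite ler_wpM2r ?invr_ge0 ?exprn_ge0// binomial_ge.
have M1 : expR (- (2 / N%:R)) <= 1 - N%:R^-1 :> R.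
  have a0 : 0 < 1 - N%:R^-1 :> R by rewrite subr_gt0 invf_lt1// ltr1n.
  rewrite expRN -[leRHS]invrK lef_pV2 ?posrE ?expR_gt0 ?invr_gt0//.
  apply: le_trans (expR_ge1Dx _).
  have -> : (1 - N%:R^-1)^-1 = N%:R / M :> R by rewrite /M; field; rewrite Nn0 N1n0.
  rewrite ler_pdivrMr//.
  have N2 : 2 <= N%:R :> R by rewrite ler_nat.
  have -> : (1 + 2 / N%:R) * M = N%:R + (N%:R - 2) / N%:R by rewrite /M; field.
  by rewrite lerDl divr_ge0// subr_ge0.
apply: (@le_trans _ _ ((expR (- (2 / N%:R))) ^+ (n - k))).
  rewrite -expRM_natl ler_expR mulrN lerN2.
  have -> : 2 * (n%:R / N%:R) = n%:R * (2 / N%:R) :> R by ring.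
  by rewrite ler_wpM2r ?divr_ge0// ler_nat leq_subr.
by rewrite lerXn2r ?nnegrE ?expR_ge0// (le_trans _ M1)// expR_ge0.
Qed.

End crowded_cell.

(** * Poisson centring *)

Section poisson_expectation.
Context {R : realType}.

(** Expectations under the Poisson law are computed as numerical series, by
splitting the integers into singletons. *)
Lemma ge0_poisson_expectation (r : R) (h : nat -> R) (l : R) : 0 < r ->
  (forall k, 0 <= h k) ->
  series (fun k => h k * exp_coeff r k) @ \oo --> l * expR r ->
  ('E_(poisson_prob r 0%N)[h])%E = l%:E.
Proof.
move=> r0 h0 hl; rewrite unlock.
have -> : [set: nat] = \bigcup_k [set k].
  by apply/seteqP; split => // k _; exists k.
rewrite ge0_integral_bigcup//; last first.
- by apply/trivIsetP => i j _ _ /eqP ij; apply/seteqP; split => // k [-> /ij].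
- by move=> x _; rewrite lee_fin.
have E k : (\int[poisson_prob r 0%N]_(x in [set k]) (h x)%:E)%E =
    (expR (- r) * (h k * exp_coeff r k))%:E.
  rewrite (eq_integral (cst (h k)%:E)); last by move=> x /[!inE] ->.
  rewrite integral_cst//= /poisson_prob r0 esum_set1 ?lee_fin ?poisson_pmf_ge0//.
  by rewrite -EFinM /poisson_pmf r0 /exp_coeff /=; congr EFin; ring.
under eq_eseriesr do rewrite E.
apply/cvg_lim => //.
rewrite (_ : (fun n => _) = EFin \o (fun n => expR (- r) * series (fun k => h k * exp_coeff r k) n)); last first.
  by apply/funext => n; rewrite sumEFin /series /= mulr_sumr.
apply: cvg_EFin; first by apply: nearW.
have -> : l = expR (- r) * (l * expR r) by rewrite mulrCA -expRD addNr expR0 mulr1.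
exact: cvgMl_tmp.
Qed.

(** The score is written in the basis [k (k - 1)], [k], [1], whose Poisson series
are shifts of the exponential series. *)
Lemma poisson_chi2_expectation (r lam : R) : 0 < r -> 0 < lam ->
  ('E_(poisson_prob r 0%N)[chi2_score lam])%E = ((r + (r - lam) ^+ 2) / lam)%:E.
Proof.
move=> r0 lam0; apply: ge0_poisson_expectation => //.
  by move=> k; rewrite /chi2_score divr_ge0 ?sqr_ge0// ltW.
set e := exp_coeff r.
have eS k : k.+1%:R * e k.+1 = r * e k.
  rewrite /e /exp_coeff /= factS natrM exprS.
  have f0 : (k`!)%:R != 0 :> R by rewrite pnatr_eq0 -lt0n fact_gt0.
  have k0 : k.+1%:R != 0 :> R by rewrite pnatr_eq0.
  by move: (k.+1%:R) k0 (k`!%:R) f0 => a a0 b b0; field; rewrite a0 b0.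
have S1 n : series (fun k => k%:R * e k) n.+1 = r * series e n.
  rewrite /series /= big_nat_recl//= mul0r add0r mulr_sumr.
  by apply: eq_big_nat => k _; rewrite eS.
have S2 n : series (fun k => k%:R * (k%:R - 1) * e k) n.+2 = r ^+ 2 * series e n.
  rewrite /series /= big_nat_recl//= big_nat_recl//= mul0r mul0r add0r subrr mulr0 mul0r add0r.
  rewrite mulr_sumr; apply: eq_big_nat => k _.
  by rewrite mulrAC eS -[k.+2%:R]natr1 addrK -mulrA [e _ * _]mulrC eS mulrA expr2.
pose u n := (r ^+ 2 * series e n + (1 - 2 * lam) * (r * series e n.+1)
   + lam ^+ 2 * series e n.+2) / lam.
rewrite -(cvg_shiftn 2).
rewrite (_ : [sequence _]_n = u); last first.
  apply/funext => n.
  change (series (fun k => chi2_score lam k * e k) (n + 2)%N = u n).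
  rewrite addn2 /u -S1 -S2 /series /= !mulr_sumr -!big_split /=.
  rewrite mulr_suml; apply: eq_big_nat => k _.
  by rewrite /chi2_score; field; rewrite gt_eqF.
have se : series e @ \oo --> expR r by exact: is_cvg_series_exp_coeff.
have se1 : (fun n => series e n.+1) @ \oo --> expR r by rewrite (cvg_shiftS (series e)).
have se2 : (fun n => series e n.+2) @ \oo --> expR r.
  by rewrite (cvg_shiftS (fun n => series e n.+1)).
have -> : (r + (r - lam) ^+ 2) / lam * expR r =
  (r ^+ 2 * expR r + (1 - 2 * lam) * (r * expR r) + lam ^+ 2 * expR r) / lam.
  by field; rewrite gt_eqF.
apply: cvgMr_tmp; apply: cvgD; last exact: cvgMl_tmp.
by apply: cvgD; apply: cvgMl_tmp => //; exact: cvgMl_tmp.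
Qed.

Lemma A1_chi2 (N n : nat) (p : 'I_N -> R) (lam := n%:R / N%:R) :
  (0 < N)%N -> (0 < n)%N -> (forall m, 0 < p m) -> \sum_m p m = 1 ->
  (N%:R%:E * A1 n p (chi2_score lam) = (N%:R + n%:R * mean_sq_dev p)%:E)%E.
Proof.
move=> N0 n0 p0 p1.
have Np : N%:R != 0 :> R by rewrite pnatr_eq0 -lt0n.
have np : n%:R != 0 :> R by rewrite pnatr_eq0 -lt0n.
have lam0 : 0 < lam by rewrite divr_gt0 ?ltr0n.
have pm m : 0 < n%:R * p m by rewrite mulr_gt0 ?ltr0n.
rewrite /A1; under eq_bigr do rewrite poisson_chi2_expectation//.
rewrite sumEFin -!EFinM mulrA divff// mul1r; congr EFin.
rewrite /mean_sq_dev.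
have s1 : \sum_m N%:R * p m = N%:R by rewrite -mulr_sumr p1 mulr1.
have c1 (c : R) : \sum_(m < N) c = N%:R * c by rewrite sumr_const card_ord -[LHS]mulr_natl.
transitivity (\sum_m (N%:R * p m + n%:R / N%:R * (N%:R * p m - 1) ^+ 2)).
  by apply: eq_bigr => m _; rewrite /lam; field; rewrite Np np.
by rewrite big_split /= s1 -mulr_sumr mulrA.
Qed.

(** With [n] balls, the chi-square statistic is an affine function of the pair
count, and its threshold [N + n eps] becomes [v eps + lam] for the excess. The
summand [lam] comes from centring pairs at [n (n - 1) / N] instead of [n^2 / N]. *)
Lemma alpha_slope_chi2 (N n : nat) (p : 'I_N -> R) (lam := n%:R / N%:R) :
  (0 < N)%N -> (0 < n)%N -> (forall m, 0 < p m) -> \sum_m p m = 1 ->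
  alpha_slope n p (chi2_score lam) =
  (- lne (excess_tail N n (n%:R * lam * mean_sq_dev p + lam))%:E)%E.
Proof.
move=> N0 n0 p0 p1; rewrite /alpha_slope A1_chi2//.
have Np : N%:R != 0 :> R by rewrite pnatr_eq0 -lt0n.
have np : n%:R != 0 :> R by rewrite pnatr_eq0 -lt0n.
have lam0 : 0 < lam by rewrite divr_gt0 ?ltr0n.
congr (- lne _%:E)%E.
pose A (x : 'I_N -> nat) := N%:R + n%:R * mean_sq_dev p < \sum_m chi2_score lam (x m).
transitivity (multinomial_prob (@uniform_cells R N)
    (fun eta : {ffun 'I_N -> 'I_n.+1} => A (fun i => eta i))).
  by apply: eq_bigl => eta; rewrite /= lte_fin.
rewrite multinomial_probE; apply: eq_killed_exp => [m|x s]; first exact: unif_ge0.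
congr (nat_of_bool _)%:R; rewrite /A /excess.
have xs : \sum_i (x i)%:R = n%:R :> R by exact: sum_natr_state.
have c1 (c : R) : \sum_(m < N) c = N%:R * c by rewrite sumr_const card_ord -[LHS]mulr_natl.
have -> : \sum_m chi2_score lam (x m) = (pairs x + n%:R - n%:R * lam) / lam.
  have -> : pairs x + n%:R - n%:R * lam = \sum_m (x m)%:R ^+ 2 - n%:R * lam.
    by rewrite sum_sqr_state xs.
  have -> : n%:R * lam = 2 * lam * \sum_i (x i)%:R - N%:R * lam ^+ 2.
    by rewrite xs /lam; field.
  rewrite -c1 mulr_sumr -!sumrB mulr_suml; apply: eq_bigr => m _.
  by rewrite /chi2_score; field; rewrite gt_eqF.
rewrite ltr_pdivlMr// -subr_gt0 -[RHS]subr_gt0; congr (0 < _).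
by rewrite /lam; field.
Qed.

End poisson_expectation.

(** * Asymptotics: the Gaussian regime *)

Section asymptotics.
Context {R : realType}.

Lemma much_less_near (a b : nat -> R) (c : R) : much_less a b -> 0 < c ->
  \forall n \near \oo, `|a n| <= c * `|b n|.
Proof. by move=> /eqoP ab c0; exact: ab. Qed.

Lemma mean_sq_dev_ge0 (N : nat) (p : 'I_N -> R) : 0 <= mean_sq_dev p.
Proof. by rewrite mulr_ge0 ?invr_ge0// sumr_ge0// => m _; exact: sqr_ge0. Qed.

(** Both regimes reduce to two-sided exponential bounds on the tail, in the scale
[y = n lam eps^2]. *)
Lemma slope_ratio_cvg (N : nat -> nat) (p : forall n, 'I_(N n) -> R)
    (lam := @lambda R N) (eps := fun n => mean_sq_dev (p n)) (l : R) :
  (\forall n \near \oo, [/\ (0 < N n)%N, (0 < n)%N & is_alternative (p n)]) ->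
  (forall tau : R, 0 < tau -> \forall n \near \oo,
    0 < n%:R * lam n * eps n ^+ 2 /\
    expR (- (n%:R * lam n * eps n ^+ 2 * (l + tau))) <=
      excess_tail (N n) n (n%:R * lam n * eps n + lam n)
      <= expR (- (n%:R * lam n * eps n ^+ 2 * (l - tau)))) ->
  (alpha_slope n (p n) (chi2_score (lam n)) *
     ((n%:R * lam n * eps n ^+ 2)^-1)%:E)%E @[n --> \oo] --> l%:E.
Proof.
move=> reg bounds.
have E : \forall n \near \oo, [/\ (0 < N n)%N, (0 < n)%N & is_alternative (p n)] ->
  0 < excess_tail (N n) n (n%:R * lam n * eps n + lam n) ->
  (alpha_slope n (p n) (chi2_score (lam n)) * ((n%:R * lam n * eps n ^+ 2)^-1)%:E)%E =
  (- ln (excess_tail (N n) n (n%:R * lam n * eps n + lam n))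
     / (n%:R * lam n * eps n ^+ 2))%:E.
  apply: nearW => n [N0 n0 [p0 p1 _]] P0.
  by rewrite (alpha_slope_chi2 N0 n0 p0 p1) lne_EFin.
apply/fine_cvgP; split.
  near=> n; rewrite (near E n)//; first by near: n.
  have : 0 < n%:R * lam n * eps n ^+ 2 /\
    expR (- (n%:R * lam n * eps n ^+ 2 * (l + 1))) <=
      excess_tail (N n) n (n%:R * lam n * eps n + lam n)
      <= expR (- (n%:R * lam n * eps n ^+ 2 * (l - 1))) by near: n; exact: bounds.
  by case=> _ /andP[h _]; exact: lt_le_trans (expR_gt0 _) h.
apply/cvgrPdist_le => tau tau0; near=> n.
have [y0 /andP[lo hi]] : 0 < n%:R * lam n * eps n ^+ 2 /\
    expR (- (n%:R * lam n * eps n ^+ 2 * (l + tau))) <=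
      excess_tail (N n) n (n%:R * lam n * eps n + lam n)
      <= expR (- (n%:R * lam n * eps n ^+ 2 * (l - tau))) by near: n; exact: bounds.
have P0 := lt_le_trans (expR_gt0 _) lo.
rewrite /= (near E n)//=; last by near: n.
move: lo hi P0 y0; move: (excess_tail _ _ _) (_ * eps n ^+ 2) => P y lo hi P0 y0.
have lo' : - (y * (l + tau)) <= ln P by rewrite -ler_expR lnK.
have hi' : ln P <= - (y * (l - tau)) by rewrite -ler_expR lnK.
rewrite distrC ler_distl ler_pdivrMr// ler_pdivlMr//; apply/andP; split; lra.
Unshelve. all: by end_near. Qed.

Lemma expR_ge_pow (m : nat) :
  exists2 a : R, 0 < a & forall x, 0 <= x -> a * x ^+ m.+1 <= expR x.
Proof.
exists (m.+1)`!%:R^-1; first by rewrite invr_gt0 ltr0n fact_gt0.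
by move=> x x0; rewrite mulrC; apply: le_trans (expR_ge1Dxn m x0); rewrite lerDr ler01.
Qed.

(** The hypotheses force [e] below [n^(-2/9)], so that [exp (c / e)] exceeds any
power of [n]. The exponent 36 is [4 * 9]: it turns [n^2 e^9 <= 1] into the power
[n^8], which beats [4 n^2 N <= n^7]. *)
Lemma polynomial_le_expR_inv (c : R) : 0 < c -> \forall n \near \oo, forall (N : nat) (e : R),
  (0 < N)%N -> 0 < e -> N%:R ^+ 3 <= n%:R ^+ 4 :> R -> n%:R ^+ 2 / N%:R * e ^+ 3 <= 1 ->
  4 * n%:R ^+ 2 * N%:R <= expR (c / e).
Proof.
move=> c0; have [a a0 expa] := expR_ge_pow 35; near=> n => N e N0 e0 Nn ne.
have Np : 0 < N%:R :> R by rewrite ltr0n.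
have N1 : 1 <= N%:R :> R by rewrite ler1n.
have n4 : 4 <= n%:R :> R by near: n; exact: nbhs_infty_ger.
have nbig : (a * c ^+ 36)^-1 <= n%:R by near: n; exact: nbhs_infty_ger.
have n0 : 0 < n%:R :> R by lra.
have Nle : N%:R <= n%:R ^+ 4 :> R.
  apply: le_trans Nn; rewrite exprS ler_peMr ?(ltW Np)//.
  by rewrite expr_ge1.
have e9 : n%:R ^+ 2 * e ^+ 9 <= 1.
  apply: (@le_trans _ _ ((n%:R ^+ 2 / N%:R * e ^+ 3) ^+ 3)); last first.
    by rewrite expr_le1// mulr_ge0 ?divr_ge0// ?exprn_ge0// ltW.
  have -> : (n%:R ^+ 2 / N%:R * e ^+ 3) ^+ 3 = n%:R ^+ 2 * e ^+ 9 * (n%:R ^+ 4 / N%:R ^+ 3).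
    by field; rewrite gt_eqF.
  rewrite ler_peMr ?mulr_ge0 ?exprn_ge0 ?(ltW e0)//.
  by rewrite ler_pdivlMr ?mul1r// exprn_gt0.
have e36 : n%:R ^+ 8 <= (e^-1) ^+ 36.
  have -> : n%:R ^+ 8 = (n%:R ^+ 2) ^+ 4 :> R by rewrite -exprM.
  have -> : (e^-1) ^+ 36 = ((e^-1) ^+ 9) ^+ 4 by rewrite -exprM.
  rewrite lerXn2r ?nnegrE ?exprn_ge0 ?invr_ge0 ?(ltW e0)//.
  by rewrite exprVn -[leRHS]mul1r ler_pdivlMr ?exprn_gt0.
have ce : 0 <= c / e by rewrite divr_ge0 ?ltW.
apply: le_trans (expa _ ce).
apply: (@le_trans _ _ (n%:R ^+ 7)).
  have -> : n%:R ^+ 7 = n%:R * n%:R ^+ 2 * n%:R ^+ 4 :> R by rewrite -!exprS -exprD.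
  rewrite ler_pM ?mulr_ge0 ?exprn_ge0// ler_wpM2r ?exprn_ge0//.
have ac : 0 < a * c ^+ 36 by rewrite mulr_gt0// exprn_gt0.
have -> : a * (c / e) ^+ 36 = a * c ^+ 36 * (e^-1) ^+ 36 by rewrite exprMn mulrA.
apply: (@le_trans _ _ (a * c ^+ 36 * n%:R ^+ 8)); last by rewrite ler_wpM2l// ltW.
rewrite [n%:R ^+ 8]exprS mulrA ler_peMl ?exprn_ge0 ?(ltW n0)//.
by move: nbig; rewrite -div1r ler_pdivrMr// mulrC.
Unshelve. all: by end_near. Qed.

Section regime.
Variables (N : nat -> nat) (p : forall n, 'I_(N n) -> R).
Arguments p : clear implicits.
Let lam := @lambda R N.
Let eps := fun n => mean_sq_dev (p n).
Hypotheses (std : @standing_assumptions R N) (int : intermediate p).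

Lemma near_cells_ge (k : nat) : \forall n \near \oo, (k <= N n)%N.
Proof. by case: std => /cvgnyPge h _ _; exact: h. Qed.

Lemma near_regular : \forall n \near \oo,
  [/\ (0 < N n)%N, (0 < n)%N & is_alternative (p n)].
Proof.
case: int => -[alt _] _ _; near=> n; split.
- by near: n; exact: near_cells_ge.
- by near: n; exact: nbhs_infty_gt.
- by near: n.
Unshelve. all: by end_near. Qed.

Lemma near_load : \forall n \near \oo,
  0 < lam n /\ n%:R * lam n = n%:R ^+ 2 / (N n)%:R.
Proof.
near=> n; have [N0 n0 _] : [/\ (0 < N n)%N, (0 < n)%N & is_alternative (p n)].
  by near: n; exact: near_regular.
by rewrite /lam /lambda divr_gt0 ?ltr0n// mulrA expr2.
Unshelve. all: by end_near. Qed.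

Lemma near_eps_load (c : R) : 0 < c -> \forall n \near \oo, lam n * eps n <= c.
Proof.
move=> c0; case: int => _ _ ml.
have H := much_less_near ml c0; near=> n.
have [l0 _] : 0 < lam n /\ n%:R * lam n = n%:R ^+ 2 / (N n)%:R by near: n; exact: near_load.
have : `|mean_sq_dev (p n)| <= c * `|(lambda N n)^-1| by near: n.
rewrite normfV !ger0_norm ?mean_sq_dev_ge0 ?(ltW l0)// ler_pdivlMr//.
by rewrite mulrC.
Unshelve. all: by end_near. Qed.

Lemma near_speed (A : R) : \forall n \near \oo,
  0 < eps n /\ A <= n%:R * lam n * eps n ^+ 2.
Proof.
case: int => _ /cvgryPge h _; near=> n.
have [l0 _] : 0 < lam n /\ n%:R * lam n = n%:R ^+ 2 / (N n)%:R by near: n; exact: near_load.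
have : Num.max A 1 <= Num.sqrt (n%:R * lambda N n) * mean_sq_dev (p n).
  by near: n; exact: h.
rewrite ge_max -/(lam n) -/(eps n) => /andP[hA h1].
have nl : 0 <= n%:R * lam n by rewrite mulr_ge0 ?(ltW l0).
have e0 : 0 < eps n.
  rewrite lt_neqAle mean_sq_dev_ge0 andbT; apply: contraTneq h1 => <-.
  by rewrite mulr0 -ltNge.
split=> //.
have -> : n%:R * lam n * eps n ^+ 2 = (Num.sqrt (n%:R * lam n) * eps n) ^+ 2.
  by rewrite [RHS]exprMn sqr_sqrtr.
rewrite (le_trans hA)// expr2 ler_peMr// (le_trans _ h1)//.
Unshelve. all: by end_near. Qed.

(** The tolerance [tau] is split into [k] for the change of measure and [d], of
order [k^2], for the generating functions. Since [1 / eps] dominates both [log n]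
and [y], dropped paths are rare enough. *)
Lemma gaussian_slope_ratio :
  (\forall n \near \oo, 1 <= n%:R * lam n ^+ 3) ->
  (forall c : R, 0 < c -> \forall n \near \oo, n%:R * lam n * eps n ^+ 3 <= c) ->
  (alpha_slope n (p n) (chi2_score (lam n)) *
     ((n%:R * lam n * eps n ^+ 2)^-1)%:E)%E @[n --> \oo] --> (4^-1)%:E.
Proof.
move=> dense cubic; apply: slope_ratio_cvg; first exact: near_regular.
move=> tau tau0; have [k [k0 k1 kt]] : exists k : R, [/\ 0 < k, k <= 1 & 5 * k <= tau].
  exists (Num.min 1 (tau / 5)); rewrite lt_min ltr01 divr_gt0// ge_min lexx; split=> //.
  by rewrite mulrC -ler_pdivlMr// ge_min lexx orbT.
have k2 : 0 < k ^+ 2 by rewrite exprn_gt0.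
have k2k : k ^+ 2 <= k by rewrite expr2 ler_piMl// ltW.
(* 350 = 7 * 50 is the ratio allowed between the two tolerances in [excess_tail_ge] *)
have [d d0 dE] : exists2 d : R, 0 < d & k ^+ 2 = 350 * d.
  by exists (k ^+ 2 / 350); [rewrite divr_gt0 ?ltr0n | field].
have d1 : d <= 1 by lra.
have [c c0 cE] : exists2 c : R, 0 < c & d = 128 * c.
  by exists (d / 128); [rewrite divr_gt0 ?ltr0n | field].
have [c1 c10 c1E] : exists2 c1 : R, 0 < c1 & c = 512 * c1.
  by exists (c / 512); [rewrite divr_gt0 ?ltr0n | field].
have poly := polynomial_le_expR_inv c0.
near=> n.
have [N0 n0 _] : [/\ (0 < N n)%N, (0 < n)%N & is_alternative (p n)].
  by near: n; exact: near_regular.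
have [l0 nlE] : 0 < lam n /\ n%:R * lam n = n%:R ^+ 2 / (N n)%:R by near: n; exact: near_load.
have [e0 yA] : 0 < eps n /\ 56 / k ^+ 2 <= n%:R * lam n * eps n ^+ 2 by near: n; exact: near_speed.
have le_k : lam n * eps n <= Num.min k c.
  by near: n; apply: near_eps_load; rewrite lt_min k0.
have /andP[le_k1 le_k2] : (lam n * eps n <= k) && (lam n * eps n <= c) by rewrite -le_min.
have cub : n%:R * lam n * eps n ^+ 3 <= c1.
  by near: n; exact: cubic.
have den : 1 <= n%:R * lam n ^+ 3 by near: n.
have Nd : (N n)%:R^-1 <= d.
  rewrite -[leRHS]invrK lef_pV2 ?posrE ?invr_gt0 ?ltr0n//.
  have : (Num.truncn d^-1 < N n)%N by near: n; exact: near_cells_ge.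
  by move=> h; rewrite ltW// -truncn_lt_nat// ?invr_ge0 ltW.
have nd : n%:R^-1 <= d.
  rewrite -[leRHS]invrK lef_pV2 ?posrE ?invr_gt0 ?ltr0n//.
  by near: n; exact: nbhs_infty_ger.
have np : 0 < n%:R :> R by rewrite ltr0n.
have Np : 0 < (N n)%:R :> R by rewrite ltr0n.
have lamE : lam n = n%:R / (N n)%:R by [].
set y := n%:R * lam n * eps n ^+ 2 in yA *.
have y56 : 56 <= k ^+ 2 * y by move: yA; rewrite ler_pdivrMr// mulrC.
have y0 : 0 < y by rewrite mulr_gt0 ?exprn_gt0// mulr_gt0.
have yk : 56 <= k * y by rewrite (le_trans y56)// ler_wpM2r// ltW.
have yE : n%:R ^+ 2 / (N n)%:R * eps n ^+ 2 = y by rewrite -nlE.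
have load : 128 * eps n * (n%:R / (N n)%:R) <= d.
  rewrite -lamE -mulrA [eps n * _]mulrC; lra.
have N3 : (N n)%:R ^+ 3 <= n%:R ^+ 4 :> R.
  move: den; rewrite lamE expr_div_n mulrA -exprS ler_pdivlMr ?exprn_gt0//.
  by rewrite mul1r.
have cub1 : n%:R ^+ 2 / (N n)%:R * eps n ^+ 3 <= 1.
  by rewrite -nlE (le_trans cub)//; lra.
have rare : 4 * n%:R ^+ 2 * (N n)%:R * expR (512 * (n%:R ^+ 2 / (N n)%:R * eps n ^+ 2))
    <= expR (d / (64 * eps n)).
  rewrite yE; have -> : d / (64 * eps n) = c / eps n + c / eps n.
    by rewrite cE; field; rewrite gt_eqF.
  rewrite expRD ler_pM ?expR_ge0 ?mulr_ge0 ?exprn_ge0//.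
    by apply: (near poly n) => //; near: n.
  rewrite ler_expR ler_pdivlMr// -mulrA.
  have -> : y * eps n = n%:R * lam n * eps n ^+ 3 by rewrite /y -mulrA -exprSr.
  lra.
have d01 : 0 < d <= 1 by rewrite d0.
have lo := @excess_tail_ge R (N n) n d (eps n) N0 n0 d01 e0 load rare Nd nd
  (n%:R * lam n * eps n + lam n) k.
have hi := @excess_tail_le R (N n) n d (eps n) N0 n0 d01 e0 load rare
  (n%:R * lam n * eps n + lam n).
rewrite yE in lo hi.
split=> //; apply/andP; split.
- apply: le_trans (lo _ _ _ _).
  + rewrite -[4^-1]lnK ?posrE ?invr_gt0// -expRD ler_expR lnV ?posrE//.
    have : ln 4 <= 3 :> R.
      by rewrite (_ : 4 = 1 + 3 :> R); [apply: le_ln1Dx; lra | ring].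
    have : y * (4 * k) + k * y <= y * tau.
      have -> : y * (4 * k) + k * y = y * (5 * k) by ring.
      by rewrite ler_wpM2l// ltW.
    move: yk; lra.
  + by rewrite k0.
  + lra.
  + apply: le_trans (expR_ge1Dx _).
    have -> : k ^+ 2 / 8 * y = k ^+ 2 * y / 8 by ring.
    lra.
  + have -> : (1 + k) * (n%:R ^+ 2 / (N n)%:R) * eps n =
      n%:R * lam n * eps n + lam n * (k * (n%:R * eps n)) by rewrite -nlE; ring.
    rewrite lerD2l ler_peMr ?(ltW l0)//.
    have : y <= k * (n%:R * eps n).
      have -> : y = lam n * eps n * (n%:R * eps n) by rewrite /y; ring.
      by rewrite ler_wpM2r// mulr_ge0// ltW.
    have : k * y <= y by rewrite ler_piMl// ltW.
    move: yk; lra.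
- apply: le_trans (hi _) _.
    by rewrite -nlE lerDl ltW.
  rewrite -{1}[2]lnK ?posrE// -expRD ler_expR.
  have : ln 2 <= 1 :> R.
    by rewrite (_ : 2 = 1 + 1 :> R); [apply: le_ln1Dx; lra | ring].
  have : y * (2 * d) + k * y <= y * tau.
    have -> : y * (2 * d) + k * y = y * (2 * d + k) by ring.
    rewrite ler_wpM2l ?(ltW y0)//; lra.
  move: yk; lra.
Unshelve. all: by end_near. Qed.

End regime.
End asymptotics.

(** * Asymptotics: the crowded regime and the rate conditions *)

Section crowded_regime.
Context {R : realType}.

Lemma crowded_threshold (k0 l k : R) : 0 < l -> 100 * l <= k0 -> 2 <= k0 ->
  2 * k0 < k -> k <= 2 * k0 + 1 ->
  k0 ^+ 2 + l + k0 ^+ 2 + 2 * l * k < k * (k - 1).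
Proof.
move=> l0 l100 k02 klt kub.
have h1 : 2 * k0 * (2 * k0 - 1) <= k * (k - 1) by rewrite ler_pM; lra.
have h2 : l * k <= l * (3 * k0) by rewrite ler_wpM2l; lra.
have h3 : 100 * l * k0 <= k0 * k0 by rewrite ler_wpM2r; lra.
have h4 : 2 * k0 <= k0 * k0 by rewrite ler_wpM2r; lra.
by rewrite expr2; lra.
Qed.

Lemma ln_le_sub1 (x : R) : 0 < x -> ln x <= x - 1.
Proof. by move=> x0; rewrite -{1}[x](subrKC 1) le_ln1Dx// ltrBrDr addNr. Qed.

(** With [k] about [2 sqrt (n lam e)] the crowded cell alone supplies four times
the required excess [n lam e], which leaves room for the fluctuation of the other
cells and for the balls taken away from them. The bounds [omega <= k0 / lam] and
[(k0 / lam)^2 = N e <= N^2 / n] show that the cell is crowded, and that the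
logarithm in its cost is controlled by [m]. *)
Lemma excess_tail_ge_cubic (N n : nat) (lam e m omega c : R) :
  (1 < N)%N -> (0 < n)%N -> lam = n%:R / N%:R -> 0 < e ->
  lam * e <= 36^-1 -> 2 <= n%:R * lam -> 8 <= n%:R * lam * e ^+ 2 ->
  n%:R * lam * e ^+ 3 = omega ^+ 2 -> 100 <= omega ->
  1 <= m -> ln (N%:R ^+ 2 / n%:R) <= m -> m <= c * omega ->
  expR (- (20 * c * (n%:R * lam * e ^+ 2))) <=
    excess_tail N n (n%:R * lam * e + lam).
Proof.
move=> N1 n0 lamE e0 le1 nl2 y8 o2 o100 m1 mln hm.
have N0 : (0 < N)%N by exact: ltnW.
have np : 0 < n%:R :> R by rewrite ltr0n.
have n1 : 1 <= n%:R :> R by rewrite ler1n.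
have Np : 0 < N%:R :> R by rewrite ltr0n.
have l0 : 0 < lam by rewrite lamE divr_gt0.
have o0 : 0 < omega by exact: lt_le_trans o100.
have v0 : 0 < n%:R * lam by rewrite mulr_gt0.
pose k0 := Num.sqrt (n%:R * lam * e).
have k02 : k0 ^+ 2 = n%:R * lam * e by rewrite sqr_sqrtr// mulr_ge0 ?(ltW v0) ?(ltW e0).
have k0p : 0 < k0 by rewrite sqrtr_gt0 mulr_gt0.
have yo : n%:R * lam * e ^+ 2 = omega * k0.
  apply/eqP; rewrite -(eqrXn2 (n := 2))//; first last.
  - by rewrite mulr_ge0 ?(ltW o0) ?(ltW k0p).
  - by rewrite mulr_ge0 ?sqr_ge0 ?(ltW v0).
  by rewrite [eqbRHS]exprMn k02 -o2; apply/eqP; ring.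
have k0l : (k0 / lam) ^+ 2 = N%:R * e.
  by rewrite expr_div_n k02 lamE; field; rewrite !gt_eqF.
have Nl : N%:R * lam = n%:R by rewrite lamE mulrC divfK// gt_eqF.
have le1' : lam * e <= 1 by apply: le_trans le1 _; rewrite invf_le1// ler1n.
have ol : omega <= k0 / lam.
  rewrite -(ler_pXn2r (n := 2))// ?nnegrE ?divr_ge0 ?(ltW o0) ?(ltW l0) ?(ltW k0p)//.
  rewrite k0l -o2 -Nl.
  have -> : N%:R * lam * lam * e ^+ 3 = N%:R * e * (lam * e) ^+ 2 by ring.
  have le0 : 0 <= lam * e by rewrite mulr_ge0 ?(ltW l0) ?(ltW e0).
  apply: ler_piMr; first by rewrite mulr_ge0 ?(ltW e0).
  by rewrite expr_le1.
have l100 : 100 * lam <= k0.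
  by move: ol; rewrite ler_pdivlMr//; apply: le_trans; rewrite ler_wpM2r// ltW.
have k0_2 : 2 <= k0.
  rewrite -(ler_pXn2r (n := 4))// ?nnegrE ?(ltW k0p)//.
  have -> : k0 ^+ 4 = n%:R * lam * (n%:R * lam * e ^+ 2) by rewrite (exprM _ 2 2) k02; ring.
  by rewrite (_ : 2 ^+ 4 = 2 * 8 :> R); [rewrite ler_pM | ring].
pose k := (Num.truncn (2 * k0)).+1.
have /andP[kle klt] : (Num.truncn (2 * k0))%:R <= 2 * k0 < k%:R.
  by apply: truncn_itv; rewrite mulr_ge0// ltW.
have kub : k%:R <= 2 * k0 + 1 by rewrite /k -natr1 lerD2r.
have kp : 0 < k%:R :> R by rewrite ltr0n.
have k3 : k%:R <= 3 * k0 by move: kub k0_2; clear; lra.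
have kn : (2 * k <= n)%N.
  rewrite -(ler_nat R) natrM.
  have : 6 * k0 <= n%:R.
    rewrite -(ler_pXn2r (n := 2))// ?nnegrE ?mulr_ge0 ?(ltW k0p)//.
    have -> : (6 * k0) ^+ 2 = n%:R * (36 * (lam * e)).
      by rewrite [LHS]exprMn k02; ring.
    rewrite [leRHS]expr2 ler_wpM2l ?(ltW np)// (le_trans _ n1)//.
    by move: le1; clear; lra.
  by move: k3; clear; lra.
have t0 : 0 < k0 ^+ 2 by rewrite exprn_gt0.
have t8 : 8 * (n%:R / N%:R) * n%:R <= (k0 ^+ 2) ^+ 2.
  rewrite -lamE; have -> : (k0 ^+ 2) ^+ 2 = n%:R * lam * e ^+ 2 * (n%:R * lam) by rewrite k02; ring.
  by rewrite -mulrA [lam * _]mulrC ler_wpM2r// ltW.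
have kb : n%:R * lam * e + lam + k0 ^+ 2 + 2 * (n%:R / N%:R) * k%:R < k%:R * (k%:R - 1).
  by rewrite -k02 -lamE crowded_threshold.
apply: le_trans (excess_tail_ge_crowded (Ordinal N0) N1 (ltn0Sn _) kn t0 t8 kb).
rewrite -lamE -[2^-1]lnK ?posrE ?invr_gt0// -expRD ler_expR lnV ?posrE// -opprD lerN2.
have ln2 : ln 2 <= 1 :> R by have := @ln_le_sub1 2 ltac:(by []); clear; lra.
have ln6 : ln 6 <= 5 :> R by have := @ln_le_sub1 6 ltac:(by []); clear; lra.
have qp : 0 < k0 / lam by rewrite divr_gt0.
have lnk : ln (2 * k%:R / lam) <= 6 * m.
  have h1 : 2 * k%:R / lam <= 6 * (k0 / lam).
    rewrite mulrA ler_wpM2r ?invr_ge0 ?(ltW l0)//.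
    by move: k3; clear; lra.
  have p1 : 0 < 2 * k%:R / lam by rewrite divr_gt0// mulr_gt0.
  have p2 : 0 < 6 * (k0 / lam) by rewrite mulr_gt0.
  have h2 : ln (2 * k%:R / lam) <= ln (6 * (k0 / lam)) by rewrite ler_ln ?posrE.
  apply: le_trans h2 _; rewrite lnM ?posrE//.
  have h3 : 2 * ln (k0 / lam) <= m.
    apply: le_trans mln; rewrite mulr_natl -lnXn//.
    have q1 : 0 < (k0 / lam) ^+ 2 by rewrite exprn_gt0.
    have q2 : 0 < N%:R ^+ 2 / n%:R :> R by rewrite divr_gt0 ?exprn_gt0.
    rewrite ler_ln ?posrE// k0l ler_pdivlMr// -Nl.
    have -> : N%:R * e * (N%:R * lam) = N%:R ^+ 2 * (lam * e) by ring.
    by rewrite ler_piMr ?exprn_ge0.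
  by move: ln6 m1 h3; clear; lra.
have h1 : k%:R * ln (2 * k%:R / lam) <= 18 * (k0 * m).
  have -> : 18 * (k0 * m) = 3 * k0 * (6 * m) by ring.
  apply: (@le_trans _ _ (k%:R * (6 * m))); first by rewrite ler_wpM2l// ltW.
  by rewrite ler_wpM2r// mulr_ge0// (le_trans ler01).
have h2 : k0 * m <= c * (n%:R * lam * e ^+ 2).
  by rewrite yo mulrA mulrC ler_wpM2r// ltW.
have h3 : k0 <= k0 * m by rewrite ler_peMr// ltW.
move: h1 h2 h3 ln2 l100 k0_2 l0; clear; move: (n%:R * lam * e ^+ 2) (k%:R * ln _) => y z.
by move: (ln 2) (k0 * m) => u w; lra.
Qed.

End crowded_regime.

Section regimes.
Context {R : realType}.
Variables (N : nat -> nat) (p : forall n, 'I_(N n) -> R).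
Arguments p : clear implicits.
Let lam := @lambda R N.
Let eps := fun n => mean_sq_dev (p n).
Hypotheses (std : @standing_assumptions R N) (int : intermediate p).

(** [lam <= max (1, lam^2)], so the rate bounds the cube of the deviation by
[1 / (n lam)] times a small constant. *)
Lemma max_rate_cubic_vanishes :
  much_less eps (fun n => (n%:R * Num.max 1 (lam n ^+ 2)) `^ (- 3^-1)) ->
  forall c : R, 0 < c -> \forall n \near \oo, n%:R * lam n * eps n ^+ 3 <= c.
Proof.
move=> ml c c0; pose c' : R := Num.min 1 c.
have c'0 : 0 < c' by rewrite lt_min ltr01.
have /andP[c'1 c'c] : (c' <= 1) && (c' <= c) by rewrite !ge_min !lexx orbT.
have H := much_less_near ml c'0; near=> n.
have [l0 _] : 0 < lam n /\ n%:R * lam n = n%:R ^+ 2 / (N n)%:R by near: n; exact: near_load std int.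
have n0 : 0 < n%:R :> R by near: n; exact: nbhs_infty_gtr.
have e0 : 0 <= eps n by exact: mean_sq_dev_ge0.
have h' : `|eps n| <= c' * `|(n%:R * Num.max 1 (lam n ^+ 2)) `^ (- 3^-1)| by near: n.
pose X := n%:R * Num.max 1 (lam n ^+ 2); rewrite -/X in h'.
have X0 : 0 < X by rewrite mulr_gt0// lt_max ltr01.
have h : eps n <= c' * X `^ (- 3^-1).
  by move: h'; rewrite !ger0_norm ?powR_ge0.
have X3 : (X `^ (- 3^-1)) ^+ 3 = X^-1.
  rewrite -powR_mulrn ?powR_ge0// -powRrM mulNr mulVf// powR_inv1// ltW//.
have e3 : eps n ^+ 3 <= c' ^+ 3 * X^-1.
  by rewrite -X3 -exprMn lerXn2r ?nnegrE ?e0 ?mulr_ge0 ?powR_ge0 ?(ltW c'0).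
have nX : n%:R * lam n <= X.
  rewrite ler_wpM2l ?(ltW n0)// le_max.
  have [l1|l1] := leP (lam n) 1; first by [].
  by rewrite expr2 ler_peMr ?(ltW l0) ?(ltW l1)// orbT.
apply: (@le_trans _ _ (X * (c' ^+ 3 * X^-1))).
  apply: ler_pM nX e3; last exact: exprn_ge0.
  by rewrite mulr_ge0 ?(ltW n0) ?(ltW l0).
rewrite mulrCA divff ?gt_eqF// mulr1 (le_trans _ c'c)// exprS ler_piMr ?(ltW c'0)//.
by rewrite expr_le1// ltW.
Unshelve. all: by end_near. Qed.

(** The exponent is at most 1/2, with equality at [gamma = 1/4]. *)
Lemma power_rate_sqr_cells_le (gamma : R) : 4^-1 < gamma <= 3^-1 ->
  much_less (fun n => (N n)%:R)
    (fun n => n%:R `^ (3 * (1 - 2 * gamma) / (4 * (1 - gamma)))) ->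
  \forall n \near \oo, (N n)%:R ^+ 2 <= n%:R :> R.
Proof.
move=> /andP[g4 g3] ml; have H := much_less_near ml (ltr01 : 0 < 1 :> R); near=> n.
have n1 : 1 <= n%:R :> R by near: n; exact: nbhs_infty_ger.
have h : (N n)%:R <= n%:R `^ (2^-1) :> R.
  apply: (@le_trans _ _ (n%:R `^ (3 * (1 - 2 * gamma) / (4 * (1 - gamma))))).
    have : `|(N n)%:R| <= 1 * `|n%:R `^ (3 * (1 - 2 * gamma) / (4 * (1 - gamma)))| :> R by near: n.
    by rewrite mul1r !ger0_norm ?powR_ge0.
  by rewrite ler_powR// ler_pdivrMr; lra.
have -> : n%:R = (n%:R `^ (2^-1)) ^+ 2 :> R.
  by rewrite -powR_mulrn ?powR_ge0// -powRrM mulVf// powRr1.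
by rewrite lerXn2r ?nnegrE ?powR_ge0.
Unshelve. all: by end_near. Qed.

Lemma sqr_cells_le_load : (\forall n \near \oo, (N n)%:R ^+ 2 <= n%:R :> R) ->
  \forall n \near \oo, n%:R <= lam n ^+ 2.
Proof.
move=> H; near=> n.
have [N0 n0 _] : [/\ (0 < N n)%N, (0 < n)%N & is_alternative (p n)].
  by near: n; exact: near_regular std int.
have h : (N n)%:R ^+ 2 <= n%:R :> R by near: n.
rewrite /lam /lambda expr_div_n ler_pdivlMr ?exprn_gt0 ?ltr0n//.
by rewrite expr2 ler_wpM2l.
Unshelve. all: by end_near. Qed.

(** Put [Y = n lam^2]. From [n <= lam^2] follows [Y^(1/4) <= lam], and then
[n lam eps^3 = Y^(1 - 3 gamma) / lam] is at most [Y^(3/4 - 3 gamma)], whose exponent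
is negative precisely because [1/4 < gamma]. *)
Lemma power_rate_cubic_vanishes (gamma : R) : 4^-1 < gamma ->
  (\forall n \near \oo, n%:R <= lam n ^+ 2) ->
  (\forall n \near \oo, eps n = (n%:R * lam n ^+ 2) `^ (- gamma)) ->
  forall c : R, 0 < c -> \forall n \near \oo, n%:R * lam n * eps n ^+ 3 <= c.
Proof.
move=> g4 Hl He c c0; pose s := 3 * gamma - 3 / 4.
have s0 : 0 < s by rewrite /s; lra.
near=> n.
have [l0 _] : 0 < lam n /\ n%:R * lam n = n%:R ^+ 2 / (N n)%:R by near: n; exact: near_load std int.
have n1 : 1 <= n%:R :> R by near: n; exact: nbhs_infty_ger.
have nc : c^-1 `^ s^-1 <= n%:R by near: n; exact: nbhs_infty_ger.
have nl : n%:R <= lam n ^+ 2 by near: n.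
have -> : eps n = (n%:R * lam n ^+ 2) `^ (- gamma) by near: n.
set Y := n%:R * lam n ^+ 2.
have n0 : 0 < n%:R :> R by lra.
have Y0 : 0 < Y by rewrite mulr_gt0// exprn_gt0.
have nY : n%:R <= Y by rewrite ler_peMr ?(ltW n0)// (le_trans n1).
have lY : Y `^ (4^-1) <= lam n.
  have -> : lam n = (lam n ^+ 4) `^ (4^-1).
    by rewrite -powR_mulrn ?(ltW l0)// -powRrM divff// powRr1 ?ltW.
  apply: ge0_ler_powR; rewrite ?nnegrE ?invr_ge0 ?exprn_ge0 ?(ltW l0) ?(ltW Y0)//.
  by rewrite /Y (exprD _ 2 2) ler_wpM2r ?exprn_ge0// ltW.
have Yn0 : Y != 0 by rewrite gt_eqF.
have -> : n%:R * lam n = Y / lam n by rewrite /Y; field; rewrite gt_eqF.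
have -> : (Y `^ (- gamma)) ^+ 3 = Y `^ (- (3 * gamma)).
  by rewrite -powR_mulrn ?powR_ge0// -powRrM; congr (_ `^ _); ring.
apply: (@le_trans _ _ (Y / Y `^ (4^-1) * Y `^ (- (3 * gamma)))).
  rewrite ler_wpM2r ?powR_ge0// ler_wpM2l ?(ltW Y0)//.
  by rewrite lef_pV2 ?posrE ?powR_gt0.
rewrite -{1}[Y]powRr1 ?(ltW Y0)// -powRN -!powRD ?Yn0 ?implybT//.
have -> : 1 + - 4^-1 + - (3 * gamma) = - s by rewrite /s; lra.
rewrite powRN -[leRHS]invrK lef_pV2 ?posrE ?powR_gt0 ?invr_gt0//.
have -> : c^-1 = (c^-1 `^ s^-1) `^ s.
  by rewrite -powRrM mulVf ?gt_eqF// powRr1// invr_ge0 ltW.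
apply: ge0_ler_powR; rewrite ?nnegrE ?powR_ge0 ?(ltW s0) ?(ltW Y0)//.
exact: le_trans nc nY.
Unshelve. all: by end_near. Qed.

(** The cost of the crowded cell is at most [20 c y], where [c] bounds
[max (1, log (N^2 / n)) / omega] and is eventually as small as desired. *)
Lemma crowded_slope_ratio (omega : nat -> R) :
  (\forall n \near \oo, 0 < omega n) ->
  (\forall n \near \oo,
     eps n = (n%:R * lam n) `^ (- 3^-1) * omega n `^ (2 / 3)) ->
  much_less (fun n => Num.max 1 (ln ((N n)%:R ^+ 2 / n%:R))) omega ->
  (alpha_slope n (p n) (chi2_score (lam n)) *
     ((n%:R * lam n * eps n ^+ 2)^-1)%:E)%E @[n --> \oo] --> 0%:E.
Proof.
move=> om0 He ml; apply: slope_ratio_cvg; first exact: near_regular std int.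
move=> tau tau0.
have [c [c0 c100 ct]] : exists c : R, [/\ 0 < c, 100 * c <= 1 & 20 * c <= tau].
  exists (Num.min 100^-1 (tau / 20)).
  rewrite lt_min divr_gt0 ?ltr0n// invr_gt0 ltr0n; split => //.
    by rewrite mulrC -ler_pdivlMr ?ltr0n// div1r ge_min lexx.
  by rewrite mulrC -ler_pdivlMr ?ltr0n// ge_min lexx orbT.
have H := much_less_near ml c0.
have [_ _ /cvgryPge nlA] := std.
near=> n.
have [N0 n0 _] : [/\ (0 < N n)%N, (0 < n)%N & is_alternative (p n)].
  by near: n; exact: near_regular std int.
have N1 : (1 < N n)%N by near: n; exact: near_cells_ge std 2.
have [l0 _] : 0 < lam n /\ n%:R * lam n = n%:R ^+ 2 / (N n)%:R by near: n; exact: near_load std int.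
have [e0 y8] : 0 < eps n /\ 8 <= n%:R * lam n * eps n ^+ 2 by near: n; exact: near_speed std int _.
have le1 : lam n * eps n <= 36^-1 by near: n; apply: near_eps_load => //; rewrite invr_gt0 ltr0n.
have nl2 : 2 <= n%:R * lam n by near: n; exact: nlA.
have o0 : 0 < omega n by near: n.
have eE : eps n = (n%:R * lam n) `^ (- 3^-1) * omega n `^ (2 / 3) by near: n.
have hm : `|Num.max 1 (ln ((N n)%:R ^+ 2 / n%:R))| <= c * `|omega n| by near: n.
set m := Num.max 1 _ in hm.
have m1 : 1 <= m by rewrite le_max lexx.
have mln : ln ((N n)%:R ^+ 2 / n%:R) <= m by rewrite le_max lexx orbT.
rewrite !ger0_norm ?(ltW o0) ?(le_trans ler01)// in hm.
have v0 : 0 < n%:R * lam n by rewrite mulr_gt0// ltr0n.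
have o2 : n%:R * lam n * eps n ^+ 3 = omega n ^+ 2.
  have a1 : ((n%:R * lam n) `^ (- 3^-1)) ^+ 3 = (n%:R * lam n)^-1.
    by rewrite -powR_mulrn ?powR_ge0// -powRrM mulNr mulVf// powR_inv1// ltW.
  have a2 : (omega n `^ (2 / 3)) ^+ 3 = omega n ^+ 2.
    by rewrite -powR_mulrn ?powR_ge0// -powRrM divfK// powR_mulrn// ltW.
  by rewrite eE exprMn a1 a2 mulrA divff ?gt_eqF// mul1r.
have o100 : 100 <= omega n.
  have h1 : 1 <= c * omega n by exact: le_trans hm.
  have h2 : 100 * (c * omega n) <= omega n by rewrite mulrA ler_piMl ?(ltW o0).
  by apply: le_trans h2; rewrite ler_peMr ?ler0n.
have y0 : 0 < n%:R * lam n * eps n ^+ 2 by rewrite mulr_gt0// exprn_gt0.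
split=> //; apply/andP; split; last first.
  rewrite sub0r mulrN opprK.
  apply: (@le_trans _ _ 1); last by rewrite -[leLHS]expR0 ler_expR mulr_ge0 ?ltW.
  rewrite -(throw_exp1 n (@unif_ge0 R (N n)) (sum_unif N0)).
  apply: ler_killed_exp => [i|x _]; first exact: unif_ge0.
  by case: (_ < _).
apply: le_trans (excess_tail_ge_cubic N1 n0 erefl e0 le1 nl2 y8 o2 o100 m1 mln hm).
by rewrite add0r ler_expR lerN2 [leLHS]mulrC ler_wpM2l ?(ltW y0).
Unshelve. all: by end_near. Qed.

End regimes.

(** * The limits of the slope *)

Theorem theorem3p4 (R : realType) (N : nat -> nat)
    (p : forall n : nat, 'I_(N n) -> R)
    (lam := @lambda R N) (eps := fun n : nat => mean_sq_dev (p n))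
    (ratio := fun n : nat =>
      (alpha_slope n (p n) (chi2_score (lam n)) *
       ((n%:R * lam n * eps n ^+ 2)^-1)%:E)%E) :
  @standing_assumptions R N -> intermediate p ->
  ((n%:R * lam n ^+ 3 @[n --> \oo] --> +oo /\
    eps <<_oo (fun n => (n%:R * Num.max 1 (lam n ^+ 2)) `^ (- 3^-1)))
   \/
   (exists gamma : R,
     [/\ 4^-1 < gamma <= 3^-1,
         (fun n => n%:R `^ ((1 - 3 * gamma) / (1 - 2 * gamma)))
           <<_oo (fun n => (N n)%:R),
         (fun n => (N n)%:R)
           <<_oo (fun n =>
             n%:R `^ (3 * (1 - 2 * gamma) / (4 * (1 - gamma)))) &
         \forall n \near \oo, eps n = (n%:R * lam n ^+ 2) `^ (- gamma)]) ->
   ratio n @[n --> \oo] --> (4^-1)%:E)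
  /\
  (forall omega : nat -> R,
     (\forall n \near \oo, 0 < omega n) ->
     (\forall n \near \oo,
        eps n = (n%:R * lam n) `^ (- 3^-1) * omega n `^ (2 / 3)) ->
     (fun n => Num.max 1 (ln ((N n)%:R ^+ 2 / n%:R))) <<_oo omega ->
     omega <<_oo (fun n => Num.sqrt (n%:R * lam n)) ->
     ratio n @[n --> \oo] --> 0%:E).
Proof.
move=> std int; split=> [[[dense ml]|[gamma [g _ ml He]]]|omega om0 He ml _].
- apply: (gaussian_slope_ratio std int); last exact: max_rate_cubic_vanishes std int ml.
  by move/cvgryPge : dense; apply.
- have Hl := sqr_cells_le_load std int (power_rate_sqr_cells_le g ml).
  apply: (gaussian_slope_ratio std int).
    near=> n.
    have [l0 _] : 0 < lam n /\ n%:R * lam n = n%:R ^+ 2 / (N n)%:R.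
      by near: n; exact: near_load std int.
    have n1 : 1 <= n%:R :> R by near: n; exact: nbhs_infty_ger.
    have nl : n%:R <= lam n ^+ 2 by near: n.
    have l1 : 1 <= lam n.
      by rewrite -(expr_ge1 (n := 2))// ?(ltW l0)// (le_trans n1).
    by rewrite mulr_ege1// exprn_ege1.
  by case/andP: g => g4 _ c c0; exact: (power_rate_cubic_vanishes std int g4 Hl He c0).
- exact: (crowded_slope_ratio std int om0 He ml).
Unshelve. all: by end_near. Qed.
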